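(* Let $\Omega\subseteq\mathbb{R}^n$ be a bounded domain, let $x\in\Omega$, and let $\varphi$ be a Dirichlet eigenfunction of $\Omega$ with eigenvalue $\lambda$, i.e. $-\Delta\varphi=\lambda\varphi$ in $\Omega$, $\varphi=0$ on $\partial\Omega$. Then for every $\lambda_0>0$, $$\varphi(x)\leq e^{\lambda/\lambda_0}\left(1-\psi_{\mathbb{R}^n\setminus\Omega}\left(\lambda_0^{-1},x\right)\right)\|\varphi\|_{L^\infty(\Omega)}.$$
   Context: For a set $S\subset\mathbb{R}^n$, a point $y$ and $t>0$, $\psi_S(t,y)$ denotes the probability that a Brownian motion in $\mathbb{R}^n$ (the diffusion whose transition density is $(4\pi t)^{-n/2}e^{-|x-y|^2/(4t)}$) started at $y$ ends up inside (hits) $S$ within time $t$. *)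

(* Defs.v *)
From HB Require Import structures.
From mathcomp Require Import all_boot all_order all_algebra.
From mathcomp Require Import all_classical all_reals all_analysis.
From mathcomp Require Import normal_distribution.
Set Implicit Arguments. Unset Strict Implicit. Unset Printing Implicit Defensive.
Import Order.TTheory GRing.Theory Num.Theory.
Import numFieldNormedType.Exports.
Local Open Scope classical_set_scope.
Local Open Scope ring_scope.

Definition unitv {R : realType} {n : nat} (i : 'I_n) : 'rV[R]_n :=
  \row_(j < n) (i == j)%:R.

Definition laplacian {R : realType} {n : nat} (f : 'rV[R]_n -> R) (y : 'rV[R]_n) : R :=
  \sum_(i < n) 'D_(unitv i) ('D_(unitv i) f) y.

Definition bounded_domain {R : realType} {n : nat} (Om : set 'rV[R]_n) : Prop :=
  Om !=set0 /\ open Om /\ connected Om /\ exists M : R, forall y, Om y -> `|y| <= M.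

Definition dirichlet_eigenfunction {R : realType} {n : nat}
    (Om : set 'rV[R]_n) (phi : 'rV[R]_n -> R) (lam : R) : Prop :=
  (forall y, Om y -> differentiable phi y)
  /\ (forall (i : 'I_n) y, Om y -> differentiable ('D_(unitv i) phi) y)
  /\ (forall (i j : 'I_n) y, Om y ->
        {for y, continuous ('D_(unitv j) ('D_(unitv i) phi))})
  /\ {within closure Om, continuous phi}
  /\ (forall y, Om y -> - laplacian phi y = lam * phi y)
  /\ (forall y, closure Om y -> ~ Om y -> phi y = 0).

(* B is a Brownian motion in R^n (generator Laplacian, i.e. transition density
   (4 pi t)^(-n/2) exp(-|x-y|^2/(4t))) started at x on the probability space P:
   continuous paths, B_0 = x, coordinates measurable, each coordinate increment
   B_t - B_s (s < t) is N(0, 2(t-s)), and the increments of all coordinates over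
   consecutive intervals of any finite increasing time grid are mutually
   independent. *)
Definition brownian_motion {R : realType} {n : nat} {d : measure_display}
    {T : measurableType d} (P : probability T R) (x : 'rV[R]_n)
    (B : R -> T -> 'rV[R]_n) : Prop :=
  (forall w, B 0 w = x)
  /\ (forall w, {within `[0, +oo[, continuous (fun t => B t w)})
  /\ (forall t (i : 'I_n), measurable_fun setT (fun w => B t w ord0 i))
  /\ (forall s t (i : 'I_n) (A : set R), 0 <= s -> s < t -> measurable A ->
        P [set w | A (B t w ord0 i - B s w ord0 i)]
        = normal_prob 0 (Num.sqrt (2 * (t - s))) A)
  /\ (forall (k : nat) (ts : 'I_k.+1 -> R),
        0 <= ts ord0 ->
        (forall j : 'I_k, ts (widen_ord (leqnSn k) j) < ts (lift ord0 j)) ->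
        forall A : 'I_n -> 'I_k -> set R, (forall i j, measurable (A i j)) ->
        P [set w | forall i j,
             A i j (B (ts (lift ord0 j)) w ord0 i - B (ts (widen_ord (leqnSn k) j)) w ord0 i)]
        = (\prod_(i < n) \prod_(j < k)
             P [set w | A i j ((B (ts (lift ord0 j)) w ord0 i
                               - B (ts (widen_ord (leqnSn k) j)) w ord0 i)%R)])%E).

Definition hit_prob {R : realType} {n : nat} {d : measure_display}
    {T : measurableType d} (P : probability T R) (B : R -> T -> 'rV[R]_n)
    (S : set 'rV[R]_n) (t : R) : R :=
  fine (P [set w | exists s, 0 <= s <= t /\ S (B s w)]).

(* Main.v *)
(**
Fix [eps > 0], let [K] be the compact set [{phi >= eps}] inside [Om] and let [U]
be [phi - eps] on [K] and [0] elsewhere.  Since [U >= phi - eps] on [Om] with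
equality on [K], the second-order Taylor expansion of [phi] at [y \in K] bounds
[U (y + z)] from below for all [z], so no smoothing or extension of [phi] across
the boundary is needed.  On a time grid of mesh [h], the independence of the
Brownian increments and their moments [0], [2 h], [O(h^2)] turn this into

  [V_(k+1) >= (1 - lam h) V_k - h * (error)],
  [V_k = E[U (B_(k h)); B_0, B_h, ..., B_(k h) \in K]],

because [Delta phi = - lam phi].  Iterating up to time [t] gives
[phi x - eps <= e^(lam t) sup |phi| P(B \in K at all grid times) + error].  Along
dyadic grids the events decrease to one contained in
[{B_s \in Om for all s <= t}], as [K] is closed and paths are continuous; killing
outside [K] rather than outside [Om] is what makes this work, since a path can
touch the boundary of [Om] between dyadic times.
*)
Require Import Defs.
From HB Require Import structures.
From mathcomp Require Import all_boot all_order all_algebra.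
From mathcomp Require Import all_classical all_reals all_analysis.
From mathcomp Require Import measurable_realfun normal_distribution.
From mathcomp Require Import ring lra.
Import Order.TTheory GRing.Theory Num.Theory.
Import numFieldNormedType.Exports.
Local Open Scope classical_set_scope.
Local Open Scope ring_scope.

(** * Normal distributions *)

(** Gaussian steps are unbounded, whereas Taylor's formula with a small remainder holds only for
    short ones. Since [U >= 0], long steps can be paid for by a quartic penalty [C * |z|^4], whose
    expectation is [O(h^2)]: summed over [t / h] steps it vanishes with the mesh, however large [C]
    is. This dictates the order of the limits: [eps] and the Hessian tolerance [eta] determine [C],
    the mesh then tends to 0, and only afterwards do [eta] and [eps]. All estimates are one-sided,
    so no stochastic calculus is involved; mean and variance must be exact, but any [O(h^2)] bound
    on the fourth moment will do. Exponential moments yield all three through elementary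
    inequalities for [expR]. Independence is given only as a product rule for events, one per
    increment; it has to be extended to random variables depending on all increments but one before
    it can be used under the expectation. *)

Section normal_density_integral.
Context {R : realType}.
Local Notation mu := (@lebesgue_measure R).
Local Open Scope ereal_scope.

Lemma measurable_EFin_normal_pdf (m s : R) (D : set R) :
  measurable_fun D (fun x => (normal_pdf m s x)%:E).
Proof. by apply/measurable_funTS/measurable_EFinP; exact: measurable_normal_pdf. Qed.

Lemma EFin_normal_pdf_ge0 (m s x : R) : 0 <= (normal_pdf m s x)%:E.
Proof. by rewrite lee_fin normal_pdf_ge0. Qed.

Import HBNNSimple.

Lemma integral_normal_prob_nnsfun (m s : R) (f : {nnsfun _ >-> R}) :
  \int[normal_prob m s]_x (f x)%:E =
  \int[mu]_x ((f x)%:E * (normal_pdf m s x)%:E).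
Proof.
under [LHS]eq_integral do rewrite fimfunE -fsumEFin//.
rewrite [LHS]ge0_integral_fsum//; last 2 first.
  - by move=> r; apply/measurable_EFinP; apply: measurable_funM => //;
      apply: measurable_indic; apply: measurable_funPTI.
  - by move=> n x _; rewrite EFinM nnfun_muleindic_ge0.
under [RHS]eq_integral => x _.
  rewrite fimfunE -fsumEFin// muleC ge0_mule_fsumr; last first.
    by move=> r; rewrite EFinM nnfun_muleindic_ge0.
  over.
rewrite [RHS]ge0_integral_fsum//; last 2 first.
  - move=> r; apply: emeasurable_funM; first exact: measurable_EFin_normal_pdf.
    by apply/measurable_EFinP; apply: measurable_funM => //;
      apply: measurable_indic; apply: measurable_funPTI.
  - by move=> n x _; rewrite mule_ge0 ?EFin_normal_pdf_ge0// EFinM nnfun_muleindic_ge0.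
apply: eq_fsbigr => r _.
rewrite integralZl_indic_nnsfun//= integral_indic//= setIT.
have [r0|r0] := leP 0%R r; last first.
  rewrite preimage_nnfun0// measure0 mule0; apply/esym/integral0_eq => x _.
  by rewrite indic0 mulr0 mule0.
under eq_integral do rewrite EFinM muleCA.
rewrite ge0_integralZl//; last 2 first.
  - apply: emeasurable_funM; first exact: measurable_EFin_normal_pdf.
    exact/measurable_EFinP.
  - by move=> x _; rewrite mule_ge0 ?EFin_normal_pdf_ge0// lee_fin.
congr (_ * _); rewrite /normal_prob [LHS]integral_mkcond; apply: eq_integral => x _.
by rewrite patchE indicE; case: ifPn => _; rewrite ?mule1 ?mule0.
Qed.

(** Monotone convergence along simple approximations, applied to both sides of the identity for
    simple functions. *)
Lemma ge0_integral_normal_prob (m s : R) (f : _ -> \bar R) :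
  measurable_fun setT f -> (forall x, 0 <= f x) ->
  \int[normal_prob m s]_x f x = \int[mu]_x (f x * (normal_pdf m s x)%:E).
Proof.
move=> mf f0; pose f_ := nnsfun_approx measurableT mf.
transitivity (limn (fun n => \int[normal_prob m s]_x (f_ n x)%:E)).
  rewrite -monotone_convergence//=.
  - apply: eq_integral => ? /[!inE] xD; apply/esym/cvg_lim => //=.
    exact: cvg_nnsfun_approx.
  - by move=> n; apply/measurable_EFinP; apply: measurable_funTS; exact: measurable_funPT.
  - by move=> n ? _; rewrite lee_fin.
  - by move=> ? _ ? ? mn; rewrite lee_fin; exact/lefP/nd_nnsfun_approx.
transitivity (limn (fun n => \int[mu]_x ((f_ n x)%:E * (normal_pdf m s x)%:E))).
  by apply: congr_lim; apply/funext => n; exact: integral_normal_prob_nnsfun.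
rewrite -monotone_convergence//=.
- apply: eq_integral => x _; apply/cvg_lim => //=.
  by apply: cvgeZr; [|exact: cvg_nnsfun_approx].
- move=> n; apply: emeasurable_funM; last exact: measurable_EFin_normal_pdf.
  by apply/measurable_EFinP; apply: measurable_funTS; exact: measurable_funPT.
- by move=> n x _; rewrite mule_ge0 ?lee_fin ?normal_pdf_ge0.
- move=> x _ a b ab; rewrite lee_wpmul2r ?EFin_normal_pdf_ge0// lee_fin.
  exact/lefP/nd_nnsfun_approx.
Qed.

End normal_density_integral.

Section normal_moments.
Context {R : realType} {d : measure_display} {T : measurableType d}.
Variables (P : probability T R) (Z : T -> R) (s : R).
Hypotheses (mZ : measurable_fun setT Z) (s0 : 0 < s).
Hypothesis lawZ : forall A : set R, measurable A -> P (Z @^-1` A) = normal_prob 0 s A.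
Local Notation mu := (@lebesgue_measure R).

Lemma ge0_expectation_normal (g : R -> R) : measurable_fun setT g ->
  (forall z, 0 <= g z) ->
  (\int[P]_w (g (Z w))%:E = \int[mu]_z (g z * normal_pdf 0 s z)%:E)%E.
Proof.
move=> mg g0; have mEg : measurable_fun [set: R] (fun z => (g z)%:E).
  exact/measurable_EFinP.
(* [normal_prob] is a measure on [measurableTypeR R], not on the canonical
   measurable structure of [R], although both have the same measurable sets. *)
have mZ' : measurable_fun setT (Z : T -> measurableTypeR R) by exact: mZ.
pose Zm : {mfun T >-> measurableTypeR R} :=
  HB.pack (Z : T -> measurableTypeR R) (isMeasurableFun.Build _ _ _ _ _ mZ').
transitivity (\int[distribution P Zm]_z (g z)%:E)%E.
  by rewrite ge0_integral_distribution//= => z; rewrite lee_fin.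
transitivity (\int[normal_prob 0 s]_z (g z)%:E)%E.
  by apply: eq_measure_integral => A mA _; exact: (lawZ A mA).
by rewrite ge0_integral_normal_prob//= => z; rewrite lee_fin.
Qed.

(* The Gaussian weight of standard deviation [s] times this exponential is [r]
   times the Gaussian weight of standard deviation [r * s]. *)
Lemma expectation_expR_sqr_normal (r : R) : 0 < r ->
  (\int[P]_w (expR (- ((r^-1 ^+ 2 - 1) / (s ^+ 2 *+ 2)) * Z w ^+ 2))%:E = r%:E)%E.
Proof.
move=> r0; rewrite (ge0_expectation_normal (fun z =>
  expR (- ((r^-1 ^+ 2 - 1) / (s ^+ 2 *+ 2)) * z ^+ 2))); last 2 first.
- apply: measurableT_comp => //; apply: measurable_funM => //.
- by move=> z; exact: expR_ge0.
transitivity (\int[mu]_z (r%:E * (normal_pdf 0 (r * s) z)%:E))%E; last first.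
  rewrite integralZl//; last exact: integrable_normal_pdf.
  by rewrite integral_normal_pdf mule1.
apply: eq_integral => z _; rewrite -EFinM; congr (_%:E).
have sn0 : s != 0 by rewrite gt_eqF.
have rn0 : r != 0 by rewrite gt_eqF.
rewrite !normal_pdfE ?mulf_neq0// /normal_peak /normal_fun.
have -> : Num.sqrt ((r * s) ^+ 2 * pi *+ 2) = r * Num.sqrt (s ^+ 2 * pi *+ 2).
  rewrite exprMn -mulrA -mulrnAr sqrtrM ?sqr_ge0//.
  by rewrite sqrtr_sqr gtr0_norm.
rewrite /= invfM -!mulrA mulVKf// mulrCA -expRD.

by congr (_ * expR _); field; rewrite sn0 rn0.
Qed.

(** Completing the square: the exponential tilt moves the mean of the density from 0 to [a * s ^+ 2]
    and leaves the factor [expR (a ^+ 2 * s ^+ 2 / 2)]. *)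
Lemma expectation_expR_normal (a : R) :
  (\int[P]_w (expR (a * Z w))%:E = (expR (a ^+ 2 * s ^+ 2 / 2))%:E)%E.
Proof.
rewrite (ge0_expectation_normal (fun z => expR (a * z))); last 2 first.
- by apply: measurableT_comp => //; exact: measurable_funM.
- by move=> z; exact: expR_ge0.
transitivity (\int[mu]_z ((expR (a ^+ 2 * s ^+ 2 / 2))%:E *
    (normal_pdf (a * s ^+ 2) s z)%:E))%E; last first.
  rewrite integralZl//; last exact: integrable_normal_pdf.
  by rewrite integral_normal_pdf mule1.
apply: eq_integral => z _; rewrite -EFinM; congr (_%:E).
have sn0 : s != 0 by rewrite gt_eqF.
rewrite !normal_pdfE// /normal_fun mulrCA -expRD [RHS]mulrCA -expRD.
by congr (_ * expR _); field.
Qed.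

Let Rintegral_one : \int[P]_(w in setT) (1 : R) = 1.
Proof.
by rewrite Rintegral_cst//= [X in fine X](@probability_setT _ _ _ P) mulr1.
Qed.

Let ge0_integrable (f : T -> R) (r : R) : measurable_fun setT f ->
  (forall w, 0 <= f w) -> (\int[P]_w (f w)%:E = r%:E)%E ->
  P.-integrable setT (fun w => (f w)%:E) /\ \int[P]_w f w = r.
Proof.
move=> mf f0 fr; split; last by rewrite /Rintegral fr.
apply/integrableP; split; first exact/measurable_EFinP.
by under eq_integral do rewrite gee0_abs ?lee_fin//; rewrite fr ltry.
Qed.

Let expR_sqr_integrable (r : R) : 0 < r ->
  let f w := expR (- ((r^-1 ^+ 2 - 1) / (s ^+ 2 *+ 2)) * Z w ^+ 2) in
  P.-integrable setT (fun w => (f w)%:E) /\ \int[P]_w f w = r.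
Proof.
move=> r0 f; apply: ge0_integrable.
- apply: measurableT_comp => //; apply: measurable_funM => //.
  exact: measurable_funX.
- by move=> w; exact: expR_ge0.
- exact: expectation_expR_sqr_normal.
Qed.

(** The exponential is the integrand of [expR_sqr_integrable] at [r = 2], with exponent [2 * u].
    From [u ^+ 2 <= (1 + u) ^+ 2 <= expR (2 * u)] comes the constant [256 / 9], rounded up to 32. *)
Let exp4_le (z : R) :
  z ^+ 4 <= 32 * s ^+ 4 * expR (- ((2^-1 ^+ 2 - 1) / (s ^+ 2 *+ 2)) * z ^+ 2).
Proof.
set u := 3 * z ^+ 2 / (16 * s ^+ 2).
have sn0 : s != 0 by rewrite gt_eqF.
have -> : - ((2^-1 ^+ 2 - 1) / (s ^+ 2 *+ 2)) * z ^+ 2 = u + u.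
  by rewrite /u; field; rewrite sn0.
have -> : z ^+ 4 = 256 / 9 * s ^+ 4 * u ^+ 2.
  by rewrite /u; field; rewrite sn0.
have u0 : 0 <= u by apply: divr_ge0; apply: mulr_ge0 => //; exact: sqr_ge0.
have uu : u ^+ 2 <= expR (u + u).
  rewrite expRD -expr2 lerXn2r ?nnegrE ?expR_ge0//.
  by rewrite (le_trans _ (expR_ge1Dx u))// lerDr.
have s4 : 0 <= s ^+ 4 by rewrite exprn_ge0// ltW.
have := ler_wpM2l s4 uu; have := mulr_ge0 s4 (expR_ge0 (u + u)); nra.
Qed.

(** The majorant at [r = 2] has expectation 2, whence 64 in place of the exact constant 3; only the
    order [s ^+ 4] matters. *)
Lemma normal_exp4 : P.-integrable setT (fun w => (Z w ^+ 4)%:E) /\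
  \int[P]_w (Z w ^+ 4) <= 64 * s ^+ 4.
Proof.
have [//|i1 e1] := expR_sqr_integrable 2.
have i2 : P.-integrable setT (fun w => ((32 * s ^+ 4) *
    expR (- ((2^-1 ^+ 2 - 1) / (s ^+ 2 *+ 2)) * Z w ^+ 2))%:E).
  by under eq_fun do rewrite EFinM; exact: integrableZl.
have i4 : P.-integrable setT (fun w => (Z w ^+ 4)%:E).
  apply: (le_integrable _ _ _ i2) => //.
    by apply/measurable_EFinP; exact: measurable_funX.
  move=> w _ /=; rewrite lee_fin !ger0_norm ?exp4_le//; last first.
    by rewrite exprn_even_ge0.
  by rewrite mulr_ge0 ?expR_ge0// mulr_ge0// exprn_ge0// ltW.
split => //; apply: le_trans (le_Rintegral measurableT i4 i2 (fun w _ => exp4_le _)) _.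
rewrite RintegralZl// e1; lra.
Qed.

Lemma integrable_normal_sqr : P.-integrable setT (fun w => (Z w ^+ 2)%:E).
Proof.
have [i4 _] := normal_exp4.
have i : P.-integrable setT (fun w => (1 + Z w ^+ 4)%:E).
  under eq_fun do rewrite EFinD; apply: integrableD => //.
  exact: finite_measure_integrable_cst.
apply: (le_integrable _ _ _ i) => //.
  by apply/measurable_EFinP; exact: measurable_funX.
move=> w _ /=; rewrite lee_fin !ger0_norm ?sqr_ge0//.
  have := sqr_ge0 (Z w ^+ 2 - 1); have := sqr_ge0 (Z w).
  by rewrite (_ : 4 = 2 * 2)%N// exprM; nra.
by rewrite addr_ge0// exprn_even_ge0.
Qed.

Lemma integrable_normal : P.-integrable setT (fun w => (Z w)%:E).
Proof.
have i2 := integrable_normal_sqr.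
have i : P.-integrable setT (fun w => (1 + Z w ^+ 2)%:E).
  under eq_fun do rewrite EFinD; apply: integrableD => //.
  exact: finite_measure_integrable_cst.
apply: (le_integrable _ _ _ i) => //; first exact/measurable_EFinP.
move=> w _ /=; rewrite lee_fin [leRHS]ger0_norm ?addr_ge0 ?sqr_ge0//.
by rewrite ler_norml; apply/andP; split; nra.
Qed.

(* [1 + a * Z <= expR (a * Z)] gives [a * E Z <= expR (a ^+ 2 * s ^+ 2 / 2) - 1]
   for all [a] of either sign, and the right-hand side is [O(a ^+ 2)]. *)
Lemma expectation_normal : \int[P]_w Z w = 0.
Proof.
set m := \int[P]_w Z w.
have key (a : R) : 1 + a * m <= expR (a ^+ 2 * s ^+ 2 / 2).
  have [||ie ee] := ge0_integrable (fun w => expR (a * Z w)) _ _ _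
    (expectation_expR_normal a).
  - by apply: measurableT_comp => //; exact: measurable_funM.
  - by move=> w; exact: expR_ge0.
  have iZ : P.-integrable setT (fun w => (a * Z w)%:E).
    by under eq_fun do rewrite EFinM; apply: integrableZl => //; exact: integrable_normal.
  have i1 : P.-integrable setT (fun w : T => (1 : R)%:E).
    exact: finite_measure_integrable_cst.
  have iD : P.-integrable setT (fun w => (1 + a * Z w)%:E).
    by under eq_fun do rewrite EFinD; exact: integrableD.
  rewrite -ee; have <- : \int[P]_w (1 + a * Z w) = 1 + a * m.
    rewrite RintegralD// RintegralZl//; last exact: integrable_normal.
    by rewrite Rintegral_one.
  by apply: le_Rintegral => // w _; exact: expR_ge1Dx.
(* The test value is [a = t * m], normalised so that [t * s ^+ 2] and [t * m ^+ 2] sum to less than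
   1. Then [v < 1 / 2], while [(1 + t * m ^+ 2) * (1 - v) <= 1] would force
   [1 - v <= t * s ^+ 2 / 2 < 1 / 2]. *)
apply/eqP/negPn/negP => mn0; set t := (1 + s ^+ 2 + m ^+ 2)^-1.
have m0 : 0 < m ^+ 2 by rewrite lt_def sqr_ge0 sqrf_eq0 mn0.
have D0 : 0 < 1 + s ^+ 2 + m ^+ 2 by rewrite !addr_gt0// exprn_gt0.
have t0 : 0 < t by rewrite invr_gt0.
have tD : t * (1 + s ^+ 2 + m ^+ 2) = 1 by rewrite mulVf// gt_eqF.
have ts : 0 < t * s ^+ 2 by rewrite mulr_gt0// exprn_gt0.
have tm : 0 < t * m ^+ 2 by rewrite mulr_gt0.
set v := (t * m) ^+ 2 * s ^+ 2 / 2.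
have vE : v = (t * s ^+ 2) * (t * m ^+ 2) / 2 by rewrite /v; ring.
have v1 : 0 <= 1 - v by rewrite vE; nra.
have /(ler_wpM2r v1) := key (t * m); rewrite -/v => {}key.
have : expR v * (1 - v) <= 1.
  by rewrite -[leRHS](expRxMexpNx_1 v) ler_wpM2l ?expR_ge0// expR_ge1Dx.
move=> /(le_trans key); rewrite (_ : t * m * m = t * m ^+ 2); last by ring.
by rewrite vE; nra.
Qed.

(* [1 - c * Z ^+ 2 <= expR (- c * Z ^+ 2)] holds for [c] of either sign; comparing
   expectations as [r] tends to [1] from both sides pins down the variance. *)
Lemma expectation_normal_sqr : \int[P]_w (Z w ^+ 2) = s ^+ 2.
Proof.
set m := \int[P]_w (Z w ^+ 2).
have i2 := integrable_normal_sqr.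
have key (r : R) : 0 < r -> 1 - (r^-1 ^+ 2 - 1) / (s ^+ 2 *+ 2) * m <= r.
  move=> r0; have [ie ee] := expR_sqr_integrable _ r0.
  set c := (r^-1 ^+ 2 - 1) / (s ^+ 2 *+ 2).
  have iZ : P.-integrable setT (fun w => (- c * Z w ^+ 2)%:E).
    by under eq_fun do rewrite EFinM; exact: integrableZl.
  have i1 : P.-integrable setT (fun w : T => (1 : R)%:E).
    exact: finite_measure_integrable_cst.
  have iD : P.-integrable setT (fun w => (1 + - c * Z w ^+ 2)%:E).
    by under eq_fun do rewrite EFinD; exact: integrableD.
  rewrite -[leRHS]ee; have <- : \int[P]_w (1 + - c * Z w ^+ 2) = 1 - c * m.
    rewrite RintegralD// RintegralZl// mulNr.
    by rewrite Rintegral_one.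
  by apply: le_Rintegral => // w _; exact: expR_ge1Dx.
have s2 : 0 < s ^+ 2 by rewrite exprn_gt0.
set v := m / s ^+ 2; have v0 : 0 <= v.
  apply: divr_ge0; last exact: ltW.
  by apply: Rintegral_ge0 => w _; exact: sqr_ge0.
(* The common factor [1 - r] changes sign at 1: values [r > 1] bound [v] from above, values [r < 1]
   from below. Explicit choices [r = 1 + e] and [r = 1 - e] replace the limit. *)
have {}key (r : R) : 0 < r -> 2 * r ^+ 2 * (1 - r) <= (1 - r) * (1 + r) * v.
  move=> r0; have := key r r0.
  rewrite -(ler_pM2l (_ : 0 < 2 * r ^+ 2)); last by rewrite mulr_gt0// exprn_gt0.
  rewrite (_ : 2 * r ^+ 2 * (1 - _) = 2 * r ^+ 2 - (1 - r ^+ 2) * v); last first.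
    by rewrite /v; field; rewrite !gt_eqF.
  by nra.
suff v1 : v = 1 by rewrite -[LHS](divfK (lt0r_neq0 s2)) -/v v1 mul1r.
apply/eqP; rewrite eq_le; apply/andP; split; rewrite leNgt; apply/negP => v1.
- set e := (v - 1) / (4 * v).
  have ev : e * v = (v - 1) / 4 by rewrite /e; field; rewrite gt_eqF//; lra.
  have e0 : 0 < e by rewrite divr_gt0; lra.
  have e1 : e < 1 by rewrite ltr_pdivrMr; lra.
  have := key (1 + e) ltac:(lra).
  by rewrite (_ : 1 - (1 + e) = - e)//; [nra|ring].
- set e := (1 - v) / 4.
  have vE : v = 1 - 4 * e by rewrite /e; field.
  have e0 : 0 < e by rewrite divr_gt0; lra.
  have := key (1 - e) ltac:(lra).
  rewrite (_ : 1 - (1 - e) = e); last by ring.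
  have ee : 0 < e * e by rewrite mulr_gt0.
  by move: v0; rewrite vE; nra.
Qed.

End normal_moments.

(** * Independence *)

Section product_expectation.
Context {R : realType} {d : measure_display} {T : measurableType d}.
Variables (P : probability T R) (X W : T -> R).
Hypotheses (mX : measurable_fun setT X) (mW : measurable_fun setT W).
Hypothesis indepXW : forall A C : set R, measurable A -> measurable C ->
  P (X @^-1` A `&` W @^-1` C) = (P (X @^-1` A) * P (W @^-1` C))%E.
Hypotheses (iX : P.-integrable setT (EFin \o X))
           (iW : P.-integrable setT (EFin \o W)).

Let mX' : measurable_fun setT (X : T -> measurableTypeR R).
Proof. exact: mX. Qed.

Let mW' : measurable_fun setT (W : T -> measurableTypeR R).
Proof. exact: mW. Qed.

Let Xm : {mfun T >-> measurableTypeR R} :=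
  HB.pack (X : T -> measurableTypeR R) (isMeasurableFun.Build _ _ _ _ _ mX').

Let Wm : {mfun T >-> measurableTypeR R} :=
  HB.pack (W : T -> measurableTypeR R) (isMeasurableFun.Build _ _ _ _ _ mW').

Let XW w : measurableTypeR R * measurableTypeR R := (X w, W w).

Let mXW : measurable_fun setT XW.
Proof. exact: measurable_fun_pair. Qed.

Let XWm : {mfun T >-> (measurableTypeR R * measurableTypeR R)%type} :=
  HB.pack XW (isMeasurableFun.Build _ _ _ _ _ mXW).

Let f (z : measurableTypeR R * measurableTypeR R) : \bar R := (z.1 * z.2)%:E.

Let mf : measurable_fun setT f.
Proof.
apply/measurable_EFinP; apply: measurable_funM.
- exact: (@measurable_fst _ _ (measurableTypeR R) (measurableTypeR R)).
- exact: (@measurable_snd _ _ (measurableTypeR R) (measurableTypeR R)).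
Qed.

(** Independence is agreement with the product measure on rectangles, and rectangles determine it;
    Fubini's theorem then becomes available for [X * W]. *)
Let joint_law S : measurable S ->
  distribution P XWm S = (distribution P Xm \x distribution P Wm)%E S.
Proof.
by move=> mS; apply/esym/product_measure_unique.
Qed.

Let integrable_marginal (Y : {mfun T >-> measurableTypeR R}) :
  P.-integrable setT (EFin \o (Y : T -> R)) ->
  (distribution P Y).-integrable setT (fun y => (y : R)%:E).
Proof.
move=> iY; apply: integrable_pushforward; rewrite ?preimage_setT//.
by apply/measurable_EFinP; exact: measurable_id.
Qed.

Let integrable_product :
  (distribution P Xm \x distribution P Wm)%E.-integrable setT f.
Proof.
apply/integrable12ltyP => //.
have /integrableP[mx fx] := integrable_marginal Xm iX.
have /integrableP[mw fw] := integrable_marginal Wm iW.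
under eq_integral => x _.
  under eq_integral => y _ do rewrite /f/= normrM EFinM.
  rewrite ge0_integralZl//; last exact: measurableT_comp.
  over.
rewrite ge0_integralZr//; last exact: integral_ge0; last exact: measurableT_comp.
by rewrite lte_mul_pinfty// ?integral_ge0// ge0_fin_numE// integral_ge0.
Qed.

Lemma integrableM_indep : P.-integrable setT (fun w => (X w * W w)%:E).
Proof.
have /integrableP[_ fi] := integrable_product.
apply/integrableP; split; first by apply/measurable_EFinP; exact: measurable_funM.
rewrite [ltLHS](_ : _ = \int[distribution P XWm]_z `|f z|)%E.
  rewrite (eq_measure_integral (distribution P Xm \x distribution P Wm)%E)//.
  by move=> S mS _; exact: joint_law.
by rewrite ge0_integral_distribution//; exact: measurableT_comp.
Qed.

Lemma RintegralM_indep :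
  \int[P]_w (X w * W w) = (\int[P]_w X w) * (\int[P]_w W w).
Proof.
have iXr := integrable_marginal Xm iX; have iWr := integrable_marginal Wm iW.
have EX : (\int[distribution P Xm]_x (x : R)%:E = \int[P]_w (X w)%:E)%E.
  rewrite integral_distribution//; exact/measurable_EFinP.
have EW : (\int[distribution P Wm]_x (x : R)%:E = \int[P]_w (W w)%:E)%E.
  rewrite integral_distribution//; exact/measurable_EFinP.
rewrite /Rintegral -fineM ?integrable_fin_num//; congr fine.
transitivity (\int[distribution P XWm]_z f z)%E.
  by rewrite integral_distribution//; exact: integrableM_indep.
rewrite (eq_measure_integral (distribution P Xm \x distribution P Wm)%E); last first.
  by move=> S mS _; exact: joint_law.
rewrite -integral12_prod_meas1//.
transitivity (\int[distribution P Xm]_x ((x : R)%:E * \int[P]_w (W w)%:E))%E.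
  apply: eq_integral => x _; rewrite /fubini_F -EW -integralZl//.
rewrite -(fineK (integrable_fin_num _ iW))//= integralZr//; rewrite EX//.
Qed.

End product_expectation.

Section independent_family.
Context {R : realType} {d : measure_display} {T : measurableType d}.
Variables (P : probability T R) (I : finType) (xi : I -> T -> R).
Hypothesis mxi : forall i, measurable_fun setT (xi i).
Hypothesis indep : forall A : I -> set R, (forall i, measurable (A i)) ->
  P [set w | forall i, A i (xi i w)] = (\prod_i P [set w | A i (xi i w)])%E.

(* Cylinders that do not constrain coordinate [i0]: they generate the
   sigma-algebra of the remaining coordinates. *)
Definition others_cylinder (i0 : I) : set (set T) :=
  [set D | exists A : I -> set R, [/\ forall i, measurable (A i), A i0 = setT &
    D = [set w | forall i, A i (xi i w)]]].

Lemma measurable_xi_others (i0 i : I) : i != i0 ->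
  measurable_fun (setT : set (g_sigma_algebraType (others_cylinder i0))) (xi i).
Proof.
move=> ii0 _ A mA; rewrite setTI; apply: sub_sigma_algebra.
exists (fun j => if j == i then A else setT); split.
- by move=> j; case: ifP.
- by rewrite eq_sym (negbTE ii0).
- apply/seteqP; split => w /=; first by move=> Aw j; case: eqP => // ->.
  by move=> /(_ i); rewrite eqxx.
Qed.

Let cylinder_measurable (A : I -> set R) : (forall i, measurable (A i)) ->
  measurable [set w | forall i, A i (xi i w)].
Proof.
move=> mA; rewrite (_ : [set w | _] = \bigcap_(i in [set: I]) (xi i @^-1` A i)).
  apply: fin_bigcap_measurable => // i _.
  by rewrite -[X in measurable X]setTI; exact: mxi.
by apply/seteqP; split => w /= h i; [move=> _; exact: h|exact: h].
Qed.

Lemma others_cylinder_measurable (i0 : I) : others_cylinder i0 `<=` measurable.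
Proof. by move=> _ [A [mA _ ->]]; exact: cylinder_measurable. Qed.

Lemma indep_others (i0 : I) (D : set T) (C : set R) :
  <<s others_cylinder i0 >> D -> measurable C ->
  P (D `&` xi i0 @^-1` C) = (P D * P (xi i0 @^-1` C))%E.
Proof.
move=> sD mC.
have mE : measurable (xi i0 @^-1` C) by rewrite -[X in measurable X]setTI; exact: mxi.
pose c : {nonneg R} := NngNum (fine_ge0 (measure_ge0 P (xi i0 @^-1` C))).
have cE : (c%:num%:E = P (xi i0 @^-1` C))%E by rewrite /= fineK// fin_num_measure.
rewrite muleC -cE.
apply: (g_sigma_algebra_measure_unique (others_cylinder i0)
  (@others_cylinder_measurable i0) (fun=> setT) _ _ (mrestr P mE) (mscale c P)) => //.
- move=> _; exists (fun=> setT); split => //.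
  by apply/seteqP; split.
- by rewrite bigcup_const//; exists 0%N.
- move=> ? ? [A [mA A0 ->]] [B [mB B0 ->]]; exists (fun i => A i `&` B i); split.
  + by move=> i; exact: measurableI.
  + by rewrite A0 B0 setTI.
  + apply/seteqP; split => w /=; first by move=> [h k] i; split.
    by move=> h; split => i; have [] := h i.
- move=> _ [A [mA A0 ->]]; rewrite [RHS](_ : _ = P (xi i0 @^-1` C) *
    P [set w | forall i, A i (xi i w)])%E; last by rewrite -cE.
  rewrite /mrestr.
  pose A' i := if i == i0 then C else A i.
  rewrite [X in P X = _](_ : _ = [set w | forall i, A' i (xi i w)]); last first.
    apply/seteqP; split => w /=.
      by move=> [h k] i; rewrite /A'; case: eqP => [->|_]; [exact: k|exact: h].
    move=> h; split; last by have := h i0; rewrite /A' eqxx.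
    move=> i; have := h i; rewrite /A'; case: eqP => [-> _|//].
    by rewrite A0.
  have mA' i : measurable (A' i) by rewrite /A'; case: ifP.
  rewrite (indep A')// (indep A)// (bigD1 i0)//= [in RHS](bigD1 i0)//= /A' eqxx; congr (_ * _)%E.
  rewrite A0 [X in (P X * _)%E](_ : _ = setT); last by apply/seteqP.
  rewrite probability_setT mul1e; apply: eq_bigr => i /negbTE ii0.
  by rewrite ii0.
- move=> _; change (P (setT `&` xi i0 @^-1` C) < +oo)%E.
  by rewrite setTI ltey_eq fin_num_measure.
Qed.

(** [X] may depend on every member of the family except [xi i0], hence also on the other coordinates
    of the same time step; mixed second-order terms rely on this. *)
Lemma expectation_indep (i0 : I) (X : T -> R) (g : R -> R) :
  measurable_fun (setT : set (g_sigma_algebraType (others_cylinder i0))) X ->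
  measurable_fun setT g -> P.-integrable setT (EFin \o X) ->
  P.-integrable setT (fun w => (g (xi i0 w))%:E) ->
  P.-integrable setT (fun w => (X w * g (xi i0 w))%:E) /\
  \int[P]_w (X w * g (xi i0 w)) = (\int[P]_w X w) * (\int[P]_w g (xi i0 w)).
Proof.
move=> mX mg iX iW.
have mX' : measurable_fun setT X by exact/measurable_EFinP/(measurable_int P).
have mW : measurable_fun setT (g \o xi i0) by exact: measurableT_comp.
have h (A C : set R) : measurable A -> measurable C ->
    P (X @^-1` A `&` (g \o xi i0) @^-1` C) =
    (P (X @^-1` A) * P ((g \o xi i0) @^-1` C))%E.
  move=> mA mC; rewrite comp_preimage; apply: indep_others.
    by have := mX measurableT A mA; rewrite setTI.
  by rewrite -[X in measurable X]setTI; exact: mg.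
split; first exact: (integrableM_indep P X (g \o xi i0)).
exact: (RintegralM_indep P X (g \o xi i0)).
Qed.

End independent_family.

(** * Taylor expansion along segments *)

Section row_vectors.
Context {R : realType} {n : nat}.
Implicit Types (y z : 'rV[R]_n) (r : R).

Lemma norm_row_lt z r : 0 < r -> (`|z| < r) <-> (forall i, `|z ord0 i| < r).
Proof.
move=> r0; rewrite /Num.norm/= mx_normrE; split.
  by move=> /bigmax_ltP[_ h] i; exact: (h (ord0, i)).
by move=> h; apply/bigmax_ltP; split => // -[i j] _; rewrite (ord1 i); exact: h.
Qed.

Lemma norm_coord_le z i : `|z ord0 i| <= `|z|.
Proof.
rewrite leNgt; apply/negP => h.
have /norm_row_lt : `|z| < `|z ord0 i| by [].
by move=> /(_ (le_lt_trans (normr_ge0 _) h))/(_ i); rewrite ltxx.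
Qed.

Lemma row_sum_unitv z : z = \sum_(i < n) z ord0 i *: unitv i.
Proof.
apply/rowP => j; rewrite summxE (bigD1 j)//= big1 ?addr0.
  by rewrite !mxE eqxx mulr1.
by move=> i ij; rewrite !mxE (negbTE ij) mulr0.
Qed.

Lemma derive_sum_unitv (f : 'rV[R]_n -> R) y z : differentiable f y ->
  'D_z f y = \sum_(i < n) z ord0 i * 'D_(unitv i) f y.
Proof.
move=> df; rewrite deriveE// {1}(row_sum_unitv z) linear_sum.
by apply: eq_bigr => i _; rewrite linearZ/= -deriveE.
Qed.

Lemma is_derive_along (f : 'rV[R]_n -> R) y z (s : R) :
  differentiable f (y + s *: z) ->
  is_derive s 1 (fun t : R => f (y + t *: z))
    (\sum_(i < n) z ord0 i * 'D_(unitv i) f (y + s *: z)).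
Proof.
move=> df; rewrite -derive_sum_unitv//.
have dz : derivable f (y + s *: z) z by exact: diff_derivable.
have E : (fun h : R => h^-1 *: (((fun t : R => f (y + t *: z)) \o shift s) (h *: (1 : R)) -
      f (y + s *: z))) =
    (fun h : R => h^-1 *: ((f \o shift (y + s *: z)) (h *: z) - f (y + s *: z))).
  apply/funext => h /=; congr (_ *: (f _ - _)).
  by rewrite [h *: 1]mulr1 scalerDl addrCA.
by split; [rewrite /derivable E|rewrite /derive E].
Qed.

Lemma sum_mul_le_sqr (a : 'I_n -> R) :
  \sum_i \sum_j `|a i| * `|a j| <= n%:R * \sum_i a i ^+ 2.
Proof.
have -> : n%:R * \sum_i a i ^+ 2 = \sum_i \sum_j (a i ^+ 2 + a j ^+ 2) / 2.
  under [RHS]eq_bigr => i _ do rewrite -mulr_suml big_split/= sumr_const card_ord.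
  rewrite -mulr_suml big_split/= sumr_const card_ord sumrMnl -[_ *+ n]mulr_natl.
  by lra.
apply: ler_sum => i _; apply: ler_sum => j _.
rewrite -(real_normK (num_real (a i))) -(real_normK (num_real (a j))).
have := sqr_ge0 (`|a i| - `|a j|); nra.
Qed.

(* Two applications of the mean value inequality to [s |-> f (y + s *: z)]. *)
Lemma taylor2_lower (f : 'rV[R]_n -> R) y z (eta : R) :
  (forall s : R, 0 <= s <= 1 -> differentiable f (y + s *: z)) ->
  (forall (i : 'I_n) (s : R), 0 <= s <= 1 ->
     differentiable ('D_(unitv i) f) (y + s *: z)) ->
  (forall (i j : 'I_n) (s : R), 0 <= s <= 1 ->
     `|'D_(unitv j) ('D_(unitv i) f) (y + s *: z) -
       'D_(unitv j) ('D_(unitv i) f) y| <= eta) ->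
  f y + \sum_i z ord0 i * 'D_(unitv i) f y
    + 2^-1 * (\sum_i \sum_j z ord0 i * z ord0 j * 'D_(unitv j) ('D_(unitv i) f) y)
    - eta * n%:R / 2 * \sum_i z ord0 i ^+ 2 <= f (y + z).
Proof.
move=> df ddf H.
pose g (s : R) := f (y + s *: z).
pose g1 (s : R) := \sum_i z ord0 i * 'D_(unitv i) f (y + s *: z).
pose g2 (s : R) :=
  \sum_i z ord0 i * \sum_j z ord0 j * 'D_(unitv j) ('D_(unitv i) f) (y + s *: z).
have dg (s : R) : 0 <= s <= 1 -> is_derive s 1 g (g1 s).
  by move=> s01; apply: is_derive_along; exact: df.
have dg1 (s : R) : 0 <= s <= 1 -> is_derive s 1 g1 (g2 s).
  move=> s01; rewrite /g1 /g2.
  rewrite [X in is_derive _ _ X _](_ : _ =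
    \sum_i (fun t : R => z ord0 i * 'D_(unitv i) f (y + t *: z))); last first.
    by apply/funext => t; rewrite fct_sumE.
  apply: is_derive_sum => i.
  by apply: is_deriveZ; exact: is_derive_along (ddf i s s01).
have g10 : g1 0 = \sum_i z ord0 i * 'D_(unitv i) f y.
  by rewrite /g1 scale0r addr0.
(* [c] is a lower bound for the second derivative of [g] on [[0, 1]]: the Hessian oscillation costs
   [eta * (\sum_i |z_i|)^2], at most [eta * n * |z|^2] in Euclidean norm. *)
set c := g2 0 - eta * n%:R * \sum_i z ord0 i ^+ 2.
have g2c (s : R) : 0 <= s <= 1 -> c <= g2 s.
  move=> s01; rewrite /c lerBlDr -lerBlDl.
  rewrite /g2 -sumrB scale0r addr0 -mulrA.
  apply: le_trans (_ : eta * \sum_i \sum_j `|z ord0 i| * `|z ord0 j| <= _).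
    rewrite mulr_sumr; apply: ler_sum => i _; rewrite -mulrBr -sumrB mulr_sumr mulr_sumr.
    apply: ler_sum => j _; rewrite -mulrBr mulrA.
    apply: le_trans (ler_norm _) _; rewrite !normrM mulrC.
    by rewrite ler_wpM2r ?mulr_ge0// distrC H.
  (* The sign of [eta] is read off the oscillation hypothesis at some index; for [n = 0] there is no
     index and all sums are empty. *)
  case: (pselect (exists i : 'I_n, True)) => [[i _]|noi].
    have eta0 : 0 <= eta by apply: le_trans (H i i 0 _); rewrite ?lexx ?ler01.
    by rewrite ler_wpM2l// sum_mul_le_sqr.
  by rewrite !big1 ?mulr0// => i; exfalso; apply: noi; exists i.
have g1c (s : R) : 0 <= s <= 1 -> g1 0 + c * s <= g1 s.
  move=> /andP[]; rewrite le_eqVlt => /predU1P[<- _|s0 s1]; first by rewrite mulr0 addr0.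
  have [||t ts] := @MVT R g1 g2 0 s s0.
  - by move=> t; rewrite in_itv/= => /andP[t0 ts]; apply: dg1; rewrite !ltW// (lt_le_trans ts).
  - apply: derivable_within_continuous => t; rewrite in_itv/= => /andP[t0 ts].
    by apply: (@ex_derive _ _ _ _ _ _ _ (dg1 t _)); rewrite t0 (le_trans ts).
  move: ts; rewrite in_itv/= subr0 => /andP[t0 ts] g1s.
  have ct : c <= g2 t by apply: g2c; rewrite ltW//= ltW// (lt_le_trans ts).
  by have := ler_wpM2r (ltW s0) ct; rewrite -g1s; lra.
(* The parabola with the initial value of [g1] as slope and with second derivative [c] is
   subtracted, so [g1c] makes the derivative of [k] nonnegative and [k 0 <= k 1] is the claim. *)
pose k (s : R) := g s - g1 0 * s - c / 2 * s ^+ 2.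
have dk (s : R) : 0 <= s <= 1 -> is_derive s 1 k (g1 s - g1 0 - c * s).
  move=> s01; have := dg s s01 => dgs; rewrite /k.
  apply: is_derive_eq.
  by rewrite /GRing.scale/=; lra.
have [|||t] := @MVT R k (fun s => g1 s - g1 0 - c * s) 0 1.
- exact: ltr01.
- by move=> t; rewrite in_itv/= => /andP[t0 ts]; apply: dk; rewrite !ltW.
- apply: derivable_within_continuous => t; rewrite in_itv/= => t01.
  exact: (@ex_derive _ _ _ _ _ _ _ (dk t t01)).
rewrite in_itv/= => /andP[t0 t1] kE.
have ct : g1 0 + c * t <= g1 t by apply: g1c; rewrite !ltW.
have : 0 <= k 1 - k 0 by rewrite kE subr0 mulr1; lra.
have -> : \sum_i \sum_j z ord0 i * z ord0 j * 'D_(unitv j) ('D_(unitv i) f) y = g2 0.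
  rewrite /g2 scale0r addr0; apply: eq_bigr => i _; rewrite mulr_sumr.
  by apply: eq_bigr => j _; rewrite mulrA.
rewrite -g10 /k /g scale0r scale1r addr0 expr1n expr0n/= !mulr0 !mulr1 !subr0 /c.
lra.
Qed.

End row_vectors.

(** * Compactness and superlevel sets *)

Section compact_uniformity.
Context {R : realType} {n : nat}.
Implicit Types (K Om : set 'rV[R]_n) (f : 'rV[R]_n -> R).

Lemma compact_bounded_at K f : compact K ->
  (forall y, K y -> {for y, continuous f}) ->
  exists M : R, forall y, K y -> `|f y| <= M.
Proof.
move=> cK cf.
have /compact_near_coveringP/(_ R +oo (fun M y => `|f y| <= M)) := cK.
move=> /(_ _)[|M [_ MK]].
  move=> y Ky; exists ([set y' | `|f y' - f y| < 1], [set M | `|f y| + 1 < M]).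
    split => /=; last exact: nbhs_pinfty_gt.
    have /cvgrPdist_lt /(_ 1 ltr01) := cf y Ky.
    by apply: filterS => y'; rewrite distrC.
  move=> [y' M]/= [h1 h2]; have := ler_distD 0 (f y') (f y); rewrite subr0.
  have := ler_normD (f y' - f y) (f y); rewrite subrK => h _.
  by rewrite (le_trans h)// ltW// (le_lt_trans _ h2)// addrC lerD2l ltW.
by exists (M + 1) => y Ky; apply: MK => //; rewrite ltrDl.
Qed.

Lemma compact_bounded_family (I : finType) K (f : I -> 'rV[R]_n -> R) :
  compact K -> (forall i y, K y -> {for y, continuous (f i)}) ->
  exists2 M : R, 0 <= M & forall i y, K y -> `|f i y| <= M.
Proof.
move=> cK cf.
have /choice[m Hm] : forall i, exists M : R, forall y, K y -> `|f i y| <= M.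
  by move=> i; apply: compact_bounded_at => // y; exact: cf.
exists (\sum_i `|m i|); first by apply: sumr_ge0.
move=> i y Ky; rewrite (le_trans (Hm i y Ky))// (le_trans (ler_norm _))//.
by rewrite (bigD1 i)//= lerDl; apply: sumr_ge0.
Qed.

(** A Lebesgue number argument: if [y'] is within [r / 2] of [y] and [|z| < r / 2], both [y'] and
    [y' + z] lie in the ball of radius [r] about [y], where each [f i] is within [eta / 2] of
    [f i y]. *)
Lemma compact_uniform_oscillation (I : finType) K Om (f : I -> 'rV[R]_n -> R)
    (eta : R) : compact K -> open Om -> K `<=` Om -> 0 < eta ->
  (forall i y, Om y -> {for y, continuous (f i)}) ->
  exists2 dlt : R, 0 < dlt & forall y z, K y -> `|z| < dlt ->
    Om (y + z) /\ forall i, `|f i (y + z) - f i y| <= eta.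
Proof.
move=> cK oO KO eta0 cf.
pose Q (dlt : R) y := forall z, `|z| < dlt ->
    Om (y + z) /\ forall i, `|f i (y + z) - f i y| <= eta.
suff : \forall dlt \near at_right (0 : R), K `<=` Q dlt.
  move=> [/= r r0 h]; exists (r / 2) => [|y z Ky zd]; first by rewrite divr_gt0.
  have := h (r / 2) _ _ y Ky z zd; apply; last by rewrite divr_gt0.
  by rewrite /= sub0r normrN gtr0_norm ?divr_gt0// ltr_pdivrMr//; nra.
move/compact_near_coveringP : cK; apply => y Ky.
have : nbhs y [set y' | Om y' /\ forall i, `|f i y - f i y'| < eta / 2].
  apply: filterI; first by apply: open_nbhs_nbhs; split => //; exact: KO.
  apply: (@filter_forall _ I (fun i y' => `|f i y - f i y'| < eta / 2)
    (nbhs y) (nbhs_filter y)) => i.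
  by have /cvgrPdist_lt := cf i y (KO _ Ky); apply; rewrite divr_gt0.
move=> /nbhs_ballP[r /= r0]; rewrite -ball_normE => yr.
exists ([set y' | `|y - y'| < r / 2], [set d | d < r / 2]).
  split => /=; last by apply: nbhs_right_lt; rewrite divr_gt0.
  by apply/nbhs_ballP; exists (r / 2); rewrite /= ?divr_gt0// -ball_normE.
move=> [y' dlt]/= [h1 h2] z zd.
have [|_ f1] := yr y'; first by rewrite /ball_/= (lt_le_trans h1)// ler_pdivrMr//; nra.
have [|O2 f2] := yr (y' + z).
  rewrite /ball_/= opprD addrA (le_lt_trans (ler_normB _ _))//.
  by rewrite (splitr r) ltrD// (lt_trans zd).
split => // i; rewrite (le_trans (ler_distD (f i y) _ _))//.
by rewrite (splitr eta) lerD ?(ltW (f1 i))// distrC ltW.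
Qed.

End compact_uniformity.

Section eigenfunction.
Context {R : realType} {n : nat}.
Variables (Om : set 'rV[R]_n) (phi : 'rV[R]_n -> R) (lam : R).
Hypotheses (domOm : bounded_domain Om) (eigphi : dirichlet_eigenfunction Om phi lam).

Let oOm : open Om. Proof. by have [_ []] := domOm. Qed.

Let bOm : exists M : R, forall y, Om y -> `|y| <= M.
Proof. by have [_ [_ []]] := domOm. Qed.

Let dphi y : Om y -> differentiable phi y.
Proof. by have [] := eigphi; move=> h _; exact: h. Qed.

Let ddphi (i : 'I_n) y : Om y -> differentiable ('D_(unitv i) phi) y.
Proof. by have [_ [h _]] := eigphi; exact: h. Qed.

Let cddphi (i j : 'I_n) y : Om y ->
  {for y, continuous ('D_(unitv j) ('D_(unitv i) phi))}.
Proof. by have [_ [_ [h _]]] := eigphi; exact: h. Qed.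

Let cphi : {within closure Om, continuous phi}.
Proof. by have [_ [_ [_ [h _]]]] := eigphi. Qed.

Lemma closure_domain_compact : compact (closure Om).
Proof.
have [M hM] := bOm; apply: bounded_closed_compact; last exact: closed_closure.
exists M; split; first exact: num_real.
move=> r Mr y cy /=; rewrite leNgt; apply/negP => ry.
have [z [Oz]] : Om `&` ball y (`|y| - r) !=set0.
  by apply: cy; apply: nbhsx_ballx; rewrite subr_gt0.
rewrite -ball_normE /ball_/= => yz.
by have := ler_normD (y - z) z; rewrite subrK; have := hM z Oz; lra.
Qed.

Lemma eigenfunction_has_ubound : has_ubound [set `|phi y| | y in Om].
Proof.
have := compact_bounded (continuous_compact cphi closure_domain_compact).
move=> [M [_ hM]]; exists (M + 1) => _ [y Oy <-].
apply: (hM (M + 1)); first by rewrite ltrDl.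
by exists y => //; exact: subset_closure.
Qed.

Definition superlevel (eps : R) : set 'rV[R]_n := Om `&` [set y | eps <= phi y].

Definition truncation (eps : R) : 'rV[R]_n -> R :=
  (fun y => phi y - eps) \_ (superlevel eps).

(** By continuity up to the boundary, a limit point outside [Om] would satisfy both [phi y = 0] and
    [eps <= phi y]; this is where the Dirichlet condition enters. *)
Lemma superlevel_closed (eps : R) : 0 < eps -> closed (superlevel eps).
Proof.
move=> e0 y cy.
have Oy : closure Om y by apply: closure_subset cy => z [].
have ey : eps <= phi y.
  rewrite leNgt; apply/negP => ye.
  have /subspace_continuousP/(_ y Oy) := cphi.
  move=> /cvgr_lt/(_ _ ye)/cy[z [[Oz ez]]]/=.
  by move=> /(_ (subset_closure Oz)); rewrite ltNge ez.
split => //; apply: contrapT => nO.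
have [_ [_ [_ [_ [_ h]]]]] := eigphi.
by move: ey; rewrite (h y Oy nO) leNgt e0.
Qed.

Lemma superlevel_compact (eps : R) : 0 < eps -> compact (superlevel eps).
Proof.
move=> e0; apply: (subclosed_compact _ closure_domain_compact).
- exact: superlevel_closed.
- by move=> y [Oy _]; exact: subset_closure.
Qed.

Lemma truncation_ge0 (eps : R) y : 0 <= truncation eps y.
Proof. by rewrite /truncation patchE; case: ifPn => // /set_mem[_]; rewrite subr_ge0. Qed.

Lemma truncation_ge (eps : R) y : Om y -> phi y - eps <= truncation eps y.
Proof.
move=> Oy; rewrite /truncation patchE; case: ifPn => // /negP.
by rewrite in_setE => h; rewrite subr_le0 ltW// ltNge; apply/negP => ey; exact: h.
Qed.

Lemma truncation_le (eps : R) y : 0 <= eps ->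
  truncation eps y <= sup [set `|phi y| | y in Om].
Proof.
move=> e0; have ub := eigenfunction_has_ubound.
rewrite /truncation patchE; case: ifPn => [/set_mem[Oy _]|_].
  rewrite (@le_trans _ _ `|phi y|)//; last by apply: ub_le_sup => //; exists y.
  by rewrite (le_trans _ (ler_norm _))// gerBl.
have [[y0 O0] _] := domOm.
by rewrite (le_trans (normr_ge0 (phi y0)))//; apply: ub_le_sup => //; exists y0.
Qed.

(* Beyond distance [dlt] the quartic term absorbs the whole Taylor polynomial;
   within it, [truncation] dominates [phi - eps], with equality at [y]. *)
Lemma truncation_taylor (eps eta : R) : 0 < eps -> 0 < eta ->
  exists2 C : R, 0 <= C & forall y (z : 'rV[R]_n), superlevel eps y ->
    truncation eps y + \sum_i z ord0 i * 'D_(unitv i) phi y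
    + 2^-1 * (\sum_i \sum_j z ord0 i * z ord0 j * 'D_(unitv j) ('D_(unitv i) phi) y)
    - eta * \sum_i z ord0 i ^+ 2 - C * \sum_i z ord0 i ^+ 4
    <= truncation eps (y + z).
Proof.
move=> e0 eta0; have cK := superlevel_compact _ e0.
have KO : superlevel eps `<=` Om by move=> y [].
have n1 : 0 < n%:R + 1 :> R by rewrite ltr_wpDl.
(* The remainder of [taylor2_lower] is [eta' * n / 2 = eta * n / (n + 1)] times the sum of squares,
   at most [eta] times it; the [+ 1] covers [n = 0]. *)
pose eta' := 2 * eta / (n%:R + 1).
have eta'0 : 0 < eta' by rewrite divr_gt0// mulr_gt0.
pose hess (ij : 'I_n * 'I_n) := 'D_(unitv ij.2) ('D_(unitv ij.1) phi).
have chess ij y : Om y -> {for y, continuous (hess ij)} by exact: cddphi.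
have [dlt d0 osc] := compact_uniform_oscillation _ _ _ hess _ cK oOm KO eta'0 chess.
have [M0 M00 HM0] := compact_bounded_family unit _ (fun=> phi) cK
  (fun _ y Ky => differentiable_continuous (dphi _ (KO _ Ky))).
have [M1 M10 HM1] := compact_bounded_family 'I_n _ (fun i => 'D_(unitv i) phi) cK
  (fun i y Ky => differentiable_continuous (ddphi i _ (KO _ Ky))).
have [M2 M20 HM2] := compact_bounded_family _ _ hess cK
  (fun ij y Ky => chess ij y (KO _ Ky)).
(* [A] bounds the Taylor polynomial at distance [dlt]. At distance [q * dlt] with [1 <= q], its
   terms grow like [1], [q], [q ^+ 2], all at most [q ^+ 4], so
   [A * q ^+ 4 = A / dlt ^+ 4 * |z| ^+ 4] dominates it. *)
pose A := M0 + n%:R * M1 * dlt + n%:R ^+ 2 * M2 * dlt ^+ 2.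
have A0 : 0 <= A by rewrite !addr_ge0 ?mulr_ge0 ?exprn_ge0 ?ler0n// ltW.
have C0 : 0 <= A / dlt ^+ 4 by rewrite divr_ge0// exprn_ge0// ltW.
exists (A / dlt ^+ 4) => // y z Ky.
have Ty : truncation eps y = phi y - eps by rewrite /truncation patchE mem_set.
have S2 : 0 <= \sum_i z ord0 i ^+ 2 by apply: sumr_ge0 => i _; exact: sqr_ge0.
have S4 : 0 <= \sum_i z ord0 i ^+ 4.
  by apply: sumr_ge0 => i _; exact: exprn_even_ge0.
have [zd|zd] := ltP `|z| dlt.
- have szd (s : R) : 0 <= s <= 1 -> `|s *: z| < dlt.
    move=> /andP[s0 s1]; rewrite (le_lt_trans _ zd)// normrZ ger0_norm//.
    by rewrite ler_piMl.
  have := taylor2_lower phi y z eta'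
    (fun s s01 => dphi _ (proj1 (osc y _ Ky (szd s s01))))
    (fun i s s01 => ddphi i _ (proj1 (osc y _ Ky (szd s s01))))
    (fun i j s s01 => proj2 (osc y _ Ky (szd s s01)) (i, j)).
  have Oyz := (osc y z Ky zd).1.
  have := truncation_ge eps _ Oyz; rewrite Ty.
  have : eta' * n%:R / 2 * \sum_i z ord0 i ^+ 2 <= eta * \sum_i z ord0 i ^+ 2.
    apply: ler_wpM2r => //; rewrite /eta'.
    rewrite (_ : _ / 2 = eta * (n%:R / (n%:R + 1))); last by field; rewrite gt_eqF.
    by rewrite ler_piMr ?(ltW eta0)// ler_pdivrMr// mul1r lerDl.
  have := mulr_ge0 C0 S4.
  by lra.
- have Z0 : 0 < `|z| by exact: lt_le_trans zd.
  have [i zi] : exists i, `|z| <= `|z ord0 i|.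
    apply: contrapT => h; suff : `|z| < `|z| by rewrite ltxx.
    apply/norm_row_lt => // i; rewrite ltNge; apply/negP => zi.
    by apply: h; exists i.
  have Z4 : `|z| ^+ 4 <= \sum_i z ord0 i ^+ 4.
    rewrite (bigD1 i)//= ler_wpDr//.
      by apply: sumr_ge0 => j _; exact: exprn_even_ge0.
    rewrite -(@ger0_norm _ (z ord0 i ^+ 4)) ?exprn_even_ge0// normrX.
    by rewrite lerXn2r ?nnegrE.
  pose q := `|z| / dlt.
  have q1 : 1 <= q by rewrite ler_pdivlMr// mul1r.
  have zE : `|z| = q * dlt by rewrite /q divfK// gt_eqF.
  have T1 : \sum_i z ord0 i * 'D_(unitv i) phi y <= n%:R * M1 * dlt * q.
    apply: le_trans (_ : \sum_(i < n) `|z| * M1 <= _).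
      apply: ler_sum => j _; rewrite (le_trans (ler_norm _))// normrM.
      by rewrite ler_pM// ?norm_coord_le// HM1.
    by rewrite sumr_const card_ord -[X in X <= _]mulr_natl zE; lra.
  have T2 : \sum_i \sum_j z ord0 i * z ord0 j * 'D_(unitv j) ('D_(unitv i) phi) y
      <= n%:R ^+ 2 * M2 * dlt ^+ 2 * q ^+ 2.
    apply: le_trans (_ : \sum_(i < n) \sum_(j < n) `|z| * `|z| * M2 <= _).
      apply: ler_sum => j _; apply: ler_sum => k _.
      rewrite (le_trans (ler_norm _))// !normrM.
      by rewrite !ler_pM// ?mulr_ge0// ?norm_coord_le// (HM2 (j, k)).
    rewrite !sumr_const card_ord -[X in X <= _]mulr_natl -[X in _ * X <= _]mulr_natl.
    by rewrite zE; lra.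
  have T0 : truncation eps y <= M0.
    rewrite Ty lerBlDr (le_trans (ler_norm _))// (le_trans (HM0 tt y Ky))//.
    by rewrite lerDl ltW.
  have T4 : A * q ^+ 4 <= A / dlt ^+ 4 * \sum_i z ord0 i ^+ 4.
    rewrite (_ : A * q ^+ 4 = A / dlt ^+ 4 * `|z| ^+ 4); first by rewrite ler_wpM2l.
    by rewrite zE; field; rewrite gt_eqF.
  have q2 : q <= q ^+ 4 by rewrite -{1}(expr1 q) ler_weXn2l.
  have q24 : q ^+ 2 <= q ^+ 4 by rewrite ler_weXn2l.
  have q4 : 1 <= q ^+ 4 by rewrite exprn_ege1.
  have B1 : 0 <= n%:R * M1 * dlt by rewrite !mulr_ge0// ltW.
  have B2 : 0 <= n%:R ^+ 2 * M2 * dlt ^+ 2 by rewrite !mulr_ge0// ?exprn_ge0// ltW.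
  have := truncation_ge0 eps (y + z).
  have : 0 <= eta * \sum_i z ord0 i ^+ 2 by rewrite mulr_ge0// ltW.
  have := ler_wpM2l M00 q4; have := ler_wpM2l B1 q2; have := ler_wpM2l B2 q24.
  have : 0 <= n%:R ^+ 2 * M2 * dlt ^+ 2 * q ^+ 2 by rewrite mulr_ge0// sqr_ge0.
  move: T0 T1 T2 T4; rewrite /A; lra.
Qed.

End eigenfunction.

(** * Measurability and dyadic times *)

Section measurable_rows.
Context {R : realType} {n : nat} {d : measure_display} {T : measurableType d}.
Variable B : T -> 'rV[R]_n.
Hypothesis mB : forall i, measurable_fun setT (fun w => B w ord0 i).

(** Only coordinates are known to be measurable. An open set is a countable union of rational cubes
    for the max norm, and membership in a cube is a condition on finitely many coordinates. *)
Lemma measurable_preimage_open (O : set 'rV[R]_n) : open O -> measurable (B @^-1` O).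
Proof.
move=> oO; pose c (q : 'rV[rat]_n * rat) : 'rV[R]_n := map_mx ratr q.1.
(* The first two conditions do not involve [w]: they make [F q] empty unless [q] encodes a cube
   inside [O], so the union can range over all [q]. *)
pose F q := [set w | (forall y, `|c q - y| < ratr q.2 -> O y) /\
  0 < ratr q.2 :> R /\ forall i, `|c q ord0 i - B w ord0 i| < ratr q.2].
rewrite (_ : B @^-1` O = \bigcup_q F q).
  apply: countable_bigcupT_measurable => // q.
  have [h|h] := pselect ((forall y, `|c q - y| < ratr q.2 -> O y) /\ 0 < ratr q.2 :> R);
      last first.
    rewrite (_ : F q = set0); first exact: measurable0.
    by apply/seteqP; split => w //= [h1 [h2 _]]; exact: (h (conj h1 h2)).
  rewrite (_ : F q = \bigcap_(i in [set: 'I_n])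
      ((fun w => `|c q ord0 i - B w ord0 i|) @^-1` [set r | r < ratr q.2])).
    apply: fin_bigcap_measurable => // i _.
    rewrite -[X in measurable X]setTI.
    have /(_ measurableT _ (measurable_itv `]-oo, (ratr q.2)[)) :
        measurable_fun setT (fun w => `|c q ord0 i - B w ord0 i|).
      by apply: measurableT_comp => //; exact: measurable_funB.
    by rewrite set_itvE.
  apply/seteqP; split => w /=; first by move=> [_ [_ hw]] i _; exact: hw.
  by move=> hw; split; [exact: h.1|split; [exact: h.2|move=> i; exact: hw]].
apply/seteqP; split => w /=; last first.
  move=> [q _ [Oq [q0 hw]]]; apply: Oq; apply/norm_row_lt => // i.
  by have := hw i; rewrite !mxE.
move=> Ow; have : nbhs (B w) O by apply: open_nbhs_nbhs.
move=> /nbhs_ballP[r /= r0]; rewrite -ball_normE => rO.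
have r2 : 0 < r / 2 by rewrite divr_gt0.
have [e] := rat_in_itvoo r2; rewrite in_itv/= => /andP[e0 er].
have /choice[v Hv] : forall i, exists v : rat, `|ratr v - B w ord0 i| < ratr e.
  move=> i; have Be : B w ord0 i - ratr e < B w ord0 i + ratr e by lra.
  have [v] := rat_in_itvoo Be.
  by rewrite in_itv/= => /andP[? ?]; exists v; rewrite ltr_norml; apply/andP; split; lra.
set q := (\row_i v i, e); exists q => //.
have cB i : `|c q ord0 i - B w ord0 i| < ratr e by rewrite /c/= !mxE.
split => // y yc; apply: rO; rewrite /ball_/=.
have : `|c q - B w| < ratr e by apply/norm_row_lt => // i; have := cB i; rewrite !mxE.
have := ler_distD (c q) (B w) y; rewrite (distrC (B w) (c q)).
by move: yc; rewrite [q.2]/=; lra.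
Qed.

Lemma measurable_preimage_closed (K : set 'rV[R]_n) : closed K -> measurable (B @^-1` K).
Proof.
move=> cK; have oK : open (~` K) by exact: closed_openC.
have := measurableC (measurable_preimage_open _ oK).
by rewrite -preimage_setC setCK.
Qed.

(** Nothing is known about [f] off [Om]. On [K], however, [a < f] is the trace of the open set of
    points of [Om] where [f] exceeds [a]. *)
Lemma measurable_comp_patch (Om K : set 'rV[R]_n) (f : 'rV[R]_n -> R) :
  open Om -> closed K -> K `<=` Om -> (forall y, Om y -> {for y, continuous f}) ->
  measurable_fun setT (fun w => (f \_ K) (B w)).
Proof.
move=> oO cK KO cf.
have mK := measurable_preimage_closed _ cK.
rewrite (_ : (fun w => _) = (f \o B) \_ (B @^-1` K)); last first.
  by apply/funext => w; rewrite !patchE.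
apply/(measurable_restrictT _ mK).
apply: (measurability _ (RGenOInfty.measurableE R)) => _ [_ [a ->] <-].
rewrite (_ : _ `&` _ = B @^-1` K `&` B @^-1` (Om `&` [set y | a < f y])); last first.
  apply/seteqP; split => w /=; rewrite in_itv/= andbT.
    by move=> [Kw aw]; split => //; split => //; exact: KO.
  by move=> [Kw [_ aw]].
apply: measurableI => //; apply: measurable_preimage_open.
rewrite openE => y [Oy ay]; apply: filterI; first exact: open_nbhs_nbhs.
exact: (cvgr_gt (f y) (cf y Oy) a ay).
Qed.

End measurable_rows.

(** For [r > 0], the points at distance at least [r] from the complement of [Om]: closed sets
    exhausting an open [Om] as [r] decreases to 0. Closed conditions pass from dyadic times to all
    times. *)
Definition inner {R : realType} {n : nat} (Om : set 'rV[R]_n) (r : R) : set 'rV[R]_n :=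
  [set y | forall v, `|v| < r -> Om (y + v)].

Lemma inner_closed {R : realType} {n : nat} (Om : set 'rV[R]_n) (r : R) :
  closed (inner Om r).
Proof.
move=> y cy v ve; have [y' [Ky' yy']] : inner Om r `&` ball y (r - `|v|) !=set0.
  by apply: cy; apply: nbhsx_ballx; rewrite subr_gt0.
have -> : y + v = y' + (y - y' + v) by rewrite addrA [y' + _]addrC subrK.
apply: Ky'; move: yy'; rewrite -ball_normE /ball_/= => yy'.
by rewrite (le_lt_trans (ler_normD _ _))// -ltrBrDr.
Qed.

Section dyadic_times.
Context {R : realType} {n : nat}.
Variables (t : R) (b : R -> 'rV[R]_n).
Hypotheses (t0 : 0 < t) (cb : {within `[0, +oo[, continuous b}).

Lemma dyadic_approx (s r : R) : 0 <= s <= t -> 0 < r ->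
  exists m k : nat, (k <= 2 ^ m)%N /\ `|s - k%:R * (t / (2 ^ m)%:R)| < r.
Proof.
(* [t / r < m + 1 <= 2 ^ m], so the mesh at level [m] is below [r]. *)
move=> /andP[s0 st] r0; pose m := Num.truncn (t / r).
pose h := t / (2 ^ m)%:R; have h0 : 0 < h by rewrite divr_gt0// ltr0n expn_gt0.
have hr : h < r.
  have tr : 0 <= t / r by rewrite divr_ge0// ltW.
  have /andP[_] := truncn_itv tr.
  rewrite ltr_pdivrMr// => tm; rewrite /h ltr_pdivrMr ?ltr0n ?expn_gt0//.
  rewrite (lt_le_trans tm)// mulrC ler_pM2l// ler_nat.
  exact: ltn_expl.
have sh : 0 <= s / h by rewrite divr_ge0// ltW.
have /andP[k1 k2] := truncn_itv sh.
exists m, (Num.truncn (s / h)); split.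
  rewrite -(ler_nat R) (le_trans k1)// ler_pdivrMr//.
  by rewrite /h mulrC divfK// pnatr_eq0 -lt0n expn_gt0.
rewrite -/h; move: k1 k2; rewrite ler_pdivlMr// ltr_pdivrMr// -natr1 mulrDl mul1r.
by move=> k1 k2; rewrite ger0_norm; lra.
Qed.

Lemma dyadic_closed (K : set 'rV[R]_n) : closed K ->
  (forall m k : nat, (k <= 2 ^ m)%N -> K (b (k%:R * (t / (2 ^ m)%:R)))) ->
  forall s, 0 <= s <= t -> K (b s).
Proof.
move=> cK Kd s st; apply: contrapT => nK.
have /subspace_continuousP/(_ s) := cb.
rewrite /= in_itv/= andbT => /(_ (proj1 (andP st))) bs.
have : nbhs (b s) (~` K) by apply: open_nbhs_nbhs; split => //; exact: closed_openC.
move=> /bs; rewrite /nbhs/= /within/= => /nbhs_ballP[r /= r0 rK].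
have [m [k [km hk]]] := dyadic_approx s r st r0.
apply: (rK (k%:R * (t / (2 ^ m)%:R))) => //; last exact: Kd.
by rewrite in_itv/= andbT mulr_ge0// divr_ge0// ltW.
Qed.

(** The path over [[0, t]] is compact, so staying in [Om] means staying at some positive distance
    from its complement. This replaces an uncountable family of conditions by countably many. *)
Lemma path_in_open_dyadic (Om : set 'rV[R]_n) : open Om ->
  (forall s, 0 <= s <= t -> Om (b s)) <->
  exists e : nat, forall m k : nat, (k <= 2 ^ m)%N ->
    inner Om e.+1%:R^-1 (b (k%:R * (t / (2 ^ m)%:R))).
Proof.
move=> oO; split => [Ob|[e He]].
  have cC : compact [set b s | s in `[0, t]].
    apply: continuous_compact; last exact: segment_compact.
    apply: continuous_subspaceW cb => s; rewrite /= !in_itv/= andbT.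
    by move=> /andP[].
  have bO : [set b s | s in `[0, t]] `<=` Om.
    by move=> _ [s + <-]; rewrite /= in_itv/=; exact: Ob.
  (* With the empty family of functions only the containment part remains: a uniform distance from
     the path to the complement of [Om]. *)
  have [r r0 hr] := compact_uniform_oscillation void _ _ (fun _ _ => 0) 1 cC oO bO
    ltr01 (fun i => match i with end).
  exists (Num.truncn r^-1) => m k km v vr.
  apply: (hr _ _ _ _).1.
    exists (k%:R * (t / (2 ^ m)%:R)) => //; rewrite /= in_itv/=.
    apply/andP; split; first by rewrite mulr_ge0// divr_ge0// ltW.
    rewrite mulrCA ler_piMr ?(ltW t0)//.
    by rewrite ler_pdivrMr ?ltr0n ?expn_gt0// mul1r ler_nat.
  rewrite (lt_trans vr)// invf_plt ?posrE//.
  have ri : 0 <= r^-1 by rewrite invr_ge0 ltW.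
  by have /andP[] := truncn_itv ri.
move=> s st; rewrite -[b s]addr0.
apply: (dyadic_closed _ (inner_closed Om e.+1%:R^-1) He _ st).
by rewrite normr0 invr_gt0.
Qed.

End dyadic_times.

(** * The discretised Brownian motion *)

Section expectations.
Context {R : realType} {d : measure_display} {T : measurableType d}.
Variable P : probability T R.

Lemma bounded_integrable (f : T -> R) (M : R) : measurable_fun setT f ->
  (forall w, `|f w| <= M) -> P.-integrable setT (fun w => (f w)%:E).
Proof.
move=> mf fM; have iM : P.-integrable setT (fun w : T => M%:E).
  exact: finite_measure_integrable_cst.
apply: (le_integrable _ _ _ iM) => //; first exact/measurable_EFinP.
by move=> w _ /=; rewrite lee_fin (le_trans (fM w))// ler_norm.
Qed.

Lemma expectation_sum_fin (I : finType) (f : I -> T -> R) :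
  (forall i, P.-integrable setT (fun w => (f i w)%:E)) ->
  P.-integrable setT (fun w => (\sum_i f i w)%:E) /\
  \int[P]_w (\sum_i f i w) = \sum_i \int[P]_w f i w.
Proof.
move=> fi; suff H (s : seq I) : P.-integrable setT (fun w => (\sum_(i <- s) f i w)%:E) /\
    \int[P]_w (\sum_(i <- s) f i w) = \sum_(i <- s) \int[P]_w f i w.
  exact: (H (index_enum I)).
elim: s => [|i s [IH1 IH2]].
  rewrite (_ : (fun w : T => _) = (fun w => 0%:E)); last first.
    by apply/funext => w; rewrite big_nil.
  split; first exact: finite_measure_integrable_cst.
  rewrite big_nil (@eq_Rintegral _ _ _ _ _ (fun=> 0)) ?Rintegral_cst ?mul0r//.
  by move=> w _; rewrite big_nil.
have iD : P.-integrable setT (fun w => (f i w + \sum_(i <- s) f i w)%:E).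
  by under eq_fun do rewrite EFinD; exact: integrableD.
split; first by rewrite (_ : (fun w : T => _) = (fun w => (f i w + \sum_(i <- s) f i w)%:E));
  [|apply/funext => w; rewrite big_cons].
have := RintegralD measurableT (fi i) IH1; rewrite /= big_cons -IH2 => <-.
by congr (Rintegral P setT _); apply/funext => w; rewrite big_cons.
Qed.

Lemma expectation_add_scale (f g : T -> R) (a : R) :
  P.-integrable setT (fun w => (f w)%:E) -> P.-integrable setT (fun w => (g w)%:E) ->
  P.-integrable setT (fun w => (f w + a * g w)%:E) /\
  \int[P]_w (f w + a * g w) = \int[P]_w f w + a * \int[P]_w g w.
Proof.
move=> fi gi; have agi : P.-integrable setT (fun w => (a * g w)%:E).
  by under eq_fun do rewrite EFinM; exact: integrableZl.
split; first by under eq_fun do rewrite EFinD; exact: integrableD.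
by rewrite (RintegralD measurableT fi agi) (RintegralZl _ measurableT gi).
Qed.

Lemma expectation_cst_fin (c : R) : \int[P]_w c = c.
Proof.
by rewrite Rintegral_cst//= [X in fine X](@probability_setT _ _ _ P) mulr1.
Qed.

Lemma expectation_indicator (A : set T) : measurable A ->
  \int[P]_w (\1_A w) = fine (P A).
Proof. by move=> mA; rewrite /Rintegral integral_indic// setIT. Qed.

End expectations.

Section survival_weight.
Context {R : realType} {n : nat} {d : measure_display} {T : measurableType d}.
Variables (W : nat -> T -> 'rV[R]_n) (k : nat) (K Om : set 'rV[R]_n).
Hypothesis mW : forall (j : nat) (i : 'I_n), (j <= k)%N ->
  measurable_fun setT (fun w => W j w ord0 i).
Hypotheses (cK : closed K) (oOm : open Om) (KO : K `<=` Om).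

Lemma measurable_stay : measurable [set w | forall j, (j <= k)%N -> K (W j w)].
Proof.
rewrite (_ : [set w | _] = \bigcap_(j in [set j | (j <= k)%N]) (W j @^-1` K)).
  apply: bigcap_measurable; first by exists 0%N.
  by move=> j jk; apply: measurable_preimage_closed => // i; exact: mW.
by apply/seteqP; split => w /= h j; exact: h.
Qed.

(** The sigma-algebra on [T] is left arbitrary, since the statement is used both for the full one
    and for the one generated by all increments but one. *)
Lemma measurable_weight (f : 'rV[R]_n -> R) : (forall y, Om y -> {for y, continuous f}) ->
  measurable_fun setT
    (fun w => \1_[set w | forall j, (j <= k)%N -> K (W j w)] w * (f \_ K) (W k w)).
Proof.
move=> cf; apply: measurable_funM.
  by apply: measurable_indic; exact: measurable_stay.
exact: (measurable_comp_patch (W k) (fun i => mW k i (leqnn k)) _ _ _ oOm cK KO cf).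
Qed.

End survival_weight.

Section brownian_grid.
Context {R : realType} {n : nat} {d : measure_display} {T : measurableType d}.
Variables (P : probability T R) (x : 'rV[R]_n) (B : R -> T -> 'rV[R]_n).
Hypothesis hB : brownian_motion P x B.
Variables (N : nat) (h : R).
Hypothesis h0 : 0 < h.

Definition grid (k : nat) : T -> 'rV[R]_n := B (k%:R * h).

Definition increment (p : 'I_n * 'I_N) (w : T) : R :=
  grid p.2.+1 w ord0 p.1 - grid p.2 w ord0 p.1.

Lemma grid0 w : grid 0 w = x.
Proof. by rewrite /grid mul0r; have [-> _] := hB. Qed.

Lemma measurable_grid k (i : 'I_n) : measurable_fun setT (fun w => grid k w ord0 i).
Proof. by have [_ [_ [h3 _]]] := hB; exact: h3. Qed.

Lemma measurable_increment p : measurable_fun setT (increment p).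
Proof. by apply: measurable_funB; exact: measurable_grid. Qed.

Lemma increment_law p (A : set R) : measurable A ->
  P (increment p @^-1` A) = normal_prob 0 (Num.sqrt (2 * h)) A.
Proof.
move=> mA; have [_ [_ [_ [h4 _]]]] := hB.
have := h4 (p.2%:R * h) (p.2.+1%:R * h) p.1 A.
rewrite -mulrBl -natrB// subSnn mul1r; apply => //.
  by rewrite mulr_ge0// ltW.
by rewrite ltr_pM2r// ltr_nat.
Qed.

Lemma increment_indep (A : 'I_n * 'I_N -> set R) : (forall p, measurable (A p)) ->
  P [set w | forall p, A p (increment p w)] =
  (\prod_p P [set w | A p (increment p w)])%E.
Proof.
move=> mA; have [_ [_ [_ [_ h5]]]] := hB.
have ts0 : 0 <= (ord0 : 'I_N.+1)%:R * h by rewrite mul0r.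
have tsS (j : 'I_N) : (widen_ord (leqnSn N) j)%:R * h < (lift ord0 j)%:R * h.
  by rewrite ltr_pM2r// ltr_nat.
have := h5 N (fun j => j%:R * h) ts0 tsS (fun i j => A (i, j)) (fun i j => mA (i, j)).
rewrite pair_bigA/= => E.
rewrite [X in P X](_ : _ = [set w | forall i j, A (i, j) (increment (i, j) w)]).
  by rewrite E; apply: eq_bigr => -[i j].
by apply/seteqP; split => w /= H; [move=> i j; exact: H|move=> -[i j]; exact: H].
Qed.

(** The position at step [k] is the fixed point [x] plus increments of steps before [k], none of
    which is [p]. *)
Lemma measurable_grid_others (p : 'I_n * 'I_N) (k : nat) (i : 'I_n) :
  (k <= p.2)%N ->
  measurable_fun (setT : set (g_sigma_algebraType (others_cylinder _ increment p)))
    (fun w => grid k w ord0 i).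
Proof.
elim: k => [|k IH] kp.
  rewrite (_ : (fun w => _) = cst (x ord0 i)); first exact: measurable_cst.
  by apply/funext => w; rewrite grid0.
have kN : (k < N)%N by rewrite (leq_trans kp)// ltnW.
rewrite (_ : (fun w => _) =
    (fun w => grid k w ord0 i + increment (i, Ordinal kN) w)); last first.
  by apply/funext => w; rewrite /increment/= addrC subrK.
apply: measurable_funD; first exact: IH (ltnW kp).
apply: measurable_xi_others.
by apply/eqP => E; move: kp; rewrite -E ltnn.
Qed.

End brownian_grid.

(** * One-step inequality for the killed expectations, and its iteration *)

Section discrete_feynman_kac.
Context {R : realType} {n : nat} {d : measure_display} {T : measurableType d}.
Variables (P : probability T R) (x : 'rV[R]_n) (B : R -> T -> 'rV[R]_n).
Hypothesis hB : brownian_motion P x B.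
Variables (Om : set 'rV[R]_n) (phi : 'rV[R]_n -> R) (lam : R).
Hypotheses (domOm : bounded_domain Om) (eigphi : dirichlet_eigenfunction Om phi lam).
Variable eps : R.
Hypothesis e0 : 0 < eps.

Local Notation K := (superlevel Om phi eps).
Local Notation U := (truncation Om phi eps).
Local Notation Msup := (sup [set `|phi y| | y in Om]).

Let oOm : open Om. Proof. by have [_ []] := domOm. Qed.

Let cK : closed K. Proof. exact: (superlevel_closed _ _ _ eigphi). Qed.

Let KO : K `<=` Om. Proof. by move=> y []. Qed.

Let cphi y : Om y -> {for y, continuous phi}.
Proof. by move=> Oy; apply: differentiable_continuous; have [h _] := eigphi; exact: h. Qed.

Let cdphi i y : Om y -> {for y, continuous ('D_(unitv i) phi)}.
Proof.
by move=> Oy; apply: differentiable_continuous; have [_ [h _]] := eigphi; exact: h.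
Qed.

Let cddphi i j y : Om y -> {for y, continuous ('D_(unitv j) ('D_(unitv i) phi))}.
Proof. by have [_ [_ [h _]]] := eigphi; exact: h. Qed.

Let cphie y : Om y -> {for y, continuous (fun y => phi y - eps)}.
Proof.
by move=> Oy; apply: continuousB; [exact: cphi|exact: cst_continuous].
Qed.

Let U0 y : ~ K y -> U y = 0.
Proof. by move=> nK; rewrite /truncation patchE memNset. Qed.

Definition stay (h : R) (k : nat) : set T :=
  [set w | forall j, (j <= k)%N -> K (grid B h j w)].

Definition value (h : R) (k : nat) : R :=
  \int[P]_w (\1_(stay h k) w * U (grid B h k w)).

Lemma measurable_stay_grid (h : R) k : 0 < h -> measurable (stay h k).
Proof.
move=> h0; apply: measurable_stay => // j i _.
exact: (measurable_grid _ _ _ hB).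
Qed.

Lemma value_integrable (h : R) k : 0 < h ->
  P.-integrable setT (fun w => (\1_(stay h k) w * U (grid B h k w))%:E).
Proof.
move=> h0; apply: (bounded_integrable _ _ Msup).
  apply: (measurable_weight (grid B h) k K Om) => // j i _.
  exact: (measurable_grid _ _ _ hB).
move=> w; rewrite normrM ger0_norm ?indicE// ger0_norm; last exact: truncation_ge0.
rewrite -[leRHS]mul1r ler_pM ?truncation_ge0 ?lern1 ?leq_b1//.
by apply: (truncation_le _ _ _ domOm eigphi); exact: ltW.
Qed.

Lemma value_le (h : R) k : 0 < h -> value h k <= Msup * fine (P (stay h k)).
Proof.
move=> h0; have mS := measurable_stay_grid h k h0.
have i1 : P.-integrable setT (fun w => (\1_(stay h k) w)%:E).
  apply: (bounded_integrable _ _ 1); first exact: measurable_indic.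
  by move=> w; rewrite indicE ger0_norm// lern1 leq_b1.
rewrite -expectation_indicator// -RintegralZl//.
have i2 : P.-integrable setT (fun w => (Msup * \1_(stay h k) w)%:E).
  by under eq_fun do rewrite EFinM; exact: integrableZl.
apply: (le_Rintegral measurableT (value_integrable h k h0) i2) => w _.
rewrite mulrC ler_wpM2r// ?indicE//.
by apply: (truncation_le _ _ _ domOm eigphi); exact: ltW.
Qed.

Lemma value0 (h : R) : value h 0 = U x.
Proof.
rewrite /value -[RHS](expectation_cst_fin P); congr (Rintegral P setT _).
apply/funext => w; rewrite indicE (grid0 _ _ _ hB).
have [Kx|nK] := pselect (K x); last by rewrite U0// mulr0.
rewrite mem_set ?mul1r// => j; rewrite leqn0 => /eqP ->.
by rewrite (grid0 _ _ _ hB).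
Qed.

Section one_step.
Variables (eta C M1 M2 : R).
Hypotheses (eta0 : 0 < eta) (C0 : 0 <= C).
Hypothesis HM1 : forall (i : 'I_n) y, K y -> `|'D_(unitv i) phi y| <= M1.
Hypothesis HM2 : forall (i j : 'I_n) y, K y ->
  `|'D_(unitv j) ('D_(unitv i) phi) y| <= M2.
Hypothesis HC : forall y (z : 'rV[R]_n), K y ->
    U y + \sum_i z ord0 i * 'D_(unitv i) phi y
    + 2^-1 * (\sum_i \sum_j z ord0 i * z ord0 j * 'D_(unitv j) ('D_(unitv i) phi) y)
    - eta * \sum_i z ord0 i ^+ 2 - C * \sum_i z ord0 i ^+ 4
    <= U (y + z).
Variables (N k : nat) (h : R).
Hypotheses (h0 : 0 < h) (kN : (k < N)%N).

Let p (i : 'I_n) : 'I_n * 'I_N := (i, Ordinal kN).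
Let Z (i : 'I_n) : T -> R := increment B N h (p i).
Let J (w : T) : R := \1_(stay h k) w.
(** Where [J] is nonzero the position is in [K], so the restriction to [K] changes no value; it
    secures measurability and boundedness of functions controlled only there. *)
Let weighted (f : 'rV[R]_n -> R) w : R := J w * (f \_ K) (grid B h k w).
Let u := weighted (fun y => phi y - eps).
Let b i := weighted ('D_(unitv i) phi).
Let c i j := weighted ('D_(unitv j) ('D_(unitv i) phi)).

Let weighted_others f (q : 'I_n * 'I_N) : (k <= q.2)%N ->
  (forall y, Om y -> {for y, continuous f}) ->
  measurable_fun (setT : set (g_sigma_algebraType (others_cylinder _ (increment B N h) q)))
    (weighted f).
Proof.
move=> kq cf.
apply: (@measurable_weight _ _ _
  (g_sigma_algebraType (others_cylinder _ (increment B N h) q)) (grid B h) k K Om) => //.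
move=> j i jk; apply: (measurable_grid_others _ _ _ hB) => //.
exact: leq_trans jk kq.
Qed.

Let weighted_measurable f : (forall y, Om y -> {for y, continuous f}) ->
  measurable_fun setT (weighted f).
Proof.
move=> cf; apply: (measurable_weight (grid B h) k K Om) => // j i _.
exact: (measurable_grid _ _ _ hB).
Qed.

Let weighted_integrable f M : (forall y, Om y -> {for y, continuous f}) ->
  (forall y, K y -> `|f y| <= M) -> P.-integrable setT (fun w => (weighted f w)%:E).
Proof.
move=> cf fM; apply: (bounded_integrable _ _ `|M|); first exact: weighted_measurable.
move=> w; rewrite /weighted /J normrM indicE patchE.
case: (_ \in stay h k); rewrite ?normr1 ?normr0 ?mul0r// mul1r.
case: ifPn; rewrite ?normr0// => /set_mem/fM h1.
by rewrite (le_trans h1)// ler_norm.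
Qed.

Let mZ i : measurable_fun setT (Z i).
Proof. exact: (measurable_increment _ _ _ hB). Qed.

Let s0 : 0 < Num.sqrt (2 * h). Proof. by rewrite sqrtr_gt0 mulr_gt0. Qed.

Let s2 : Num.sqrt (2 * h) ^+ 2 = 2 * h.
Proof. by rewrite sqr_sqrtr// mulr_ge0// ltW. Qed.

Let lawZ i (A : set R) : measurable A ->
  P (Z i @^-1` A) = normal_prob 0 (Num.sqrt (2 * h)) A.
Proof. exact: (increment_law _ _ _ hB). Qed.

Let indepZ i (X : T -> R) (g : R -> R) :
  measurable_fun (setT : set (g_sigma_algebraType
    (others_cylinder _ (increment B N h) (p i)))) X ->
  measurable_fun setT g -> P.-integrable setT (fun w => (X w)%:E) ->
  P.-integrable setT (fun w => (g (Z i w))%:E) ->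
  P.-integrable setT (fun w => (X w * g (Z i w))%:E) /\
  \int[P]_w (X w * g (Z i w)) = (\int[P]_w X w) * (\int[P]_w g (Z i w)).
Proof.
exact: (expectation_indep P _ (increment B N h)
  (measurable_increment P x B hB N h) (increment_indep P x B hB N h h0) (p i) X g).
Qed.

Let ib i : P.-integrable setT (fun w => (b i w)%:E).
Proof. by apply: (weighted_integrable _ M1); [exact: cdphi|exact: HM1]. Qed.

Let ic i j : P.-integrable setT (fun w => (c i j w)%:E).
Proof. by apply: (weighted_integrable _ M2); [exact: cddphi|exact: HM2]. Qed.

Let iZ i : P.-integrable setT (fun w => (Z i w)%:E).
Proof. exact: (integrable_normal P _ _ (mZ i) s0 (lawZ i)). Qed.

Let first_order i :
  P.-integrable setT (fun w => (b i w * Z i w)%:E) /\ \int[P]_w (b i w * Z i w) = 0.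
Proof.
have [|||| h1 h2] := indepZ i (b i) id => //.
  by apply: weighted_others => //; exact: cdphi.
split => //; rewrite h2 (expectation_normal P _ _ (mZ i) s0 (lawZ i)) mulr0//.
Qed.

(** On the diagonal the variance [2 * h] factors out. Off it, [Z i] is absorbed into the factor
    independent of [Z j], and [Z j] has mean 0. *)
Let second_order i j :
  P.-integrable setT (fun w => (c i j w * Z i w * Z j w)%:E) /\
  \int[P]_w (c i j w * Z i w * Z j w) = if i == j then 2 * h * \int[P]_w c i i w else 0.
Proof.
have mc (q : 'I_n * 'I_N) : (k <= q.2)%N -> _ := fun kq => weighted_others _ q kq (cddphi i j).
case: eqVneq => [<-|ij].
  have [||| |h1 h2] := indepZ i (c i i) (fun z => z ^+ 2) => //.
  - by apply: weighted_others => //; exact: cddphi.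
  - exact: (integrable_normal_sqr P _ _ (mZ i) s0 (lawZ i)).
  under eq_fun do rewrite -mulrA -expr2.
  split => //; under eq_Rintegral do rewrite -mulrA -expr2.
  by rewrite h2 (expectation_normal_sqr P _ _ (mZ i) s0 (lawZ i)) s2 mulrC.
have [|||| h1 _] := indepZ i (c i j) id => //; first exact: mc.
have [|||| h3 h4] := indepZ j (fun w => c i j w * Z i w) id => //.
  apply: measurable_funM; first exact: mc.
  apply: measurable_xi_others; apply/eqP => -[E].
  by move: ij; rewrite E eqxx.
by split => //; rewrite h4 (expectation_normal P _ _ (mZ j) s0 (lawZ j)) mulr0.
Qed.

(** On the survival event this is [HC] at the current position with the next increment; off it, the
    right side is 0 and only the negative penalties remain on the left. *)
Let pointwise w :
  u w + \sum_i b i w * Z i w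
  + 2^-1 * (\sum_(q : 'I_n * 'I_n) c q.1 q.2 w * Z q.1 w * Z q.2 w)
  - eta * (\sum_i Z i w ^+ 2) - C * (\sum_i Z i w ^+ 4)
  <= J w * U (grid B h k.+1 w).
Proof.
rewrite /u /b /c /weighted; have [Sw|nS] := pselect (stay h k w).
  have Kw : K (grid B h k w) by exact: Sw.
  have J1 : J w = 1 by rewrite /J indicE mem_set.
  have := HC (grid B h k w) (grid B h k.+1 w - grid B h k w) Kw.
  have -> : grid B h k w + (grid B h k.+1 w - grid B h k w) = grid B h k.+1 w.
    by rewrite addrC subrK.
  rewrite J1 !mul1r; congr (_ <= _).
  have ZE i : (grid B h k.+1 w - grid B h k w) ord0 i = Z i w by rewrite !mxE.
  congr (_ + _ + _ * _ - _ * _ - _ * _).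
  - by apply: eq_bigr => i _; rewrite ZE mul1r patchE mem_set// mulrC.
  - rewrite pair_bigA/=; apply: eq_bigr => -[i j] _ /=.
    by rewrite !ZE mul1r patchE mem_set//; ring.
  - by apply: eq_bigr => i _; rewrite ZE.
  - by apply: eq_bigr => i _; rewrite ZE.
have J0 : J w = 0 by rewrite /J indicE memNset.
rewrite J0 !mul0r (eq_bigr (fun=> 0)) => [|i _]; last by rewrite !mul0r.
rewrite big1_eq (eq_bigr (fun=> 0)) => [|i _]; last by rewrite !mul0r.
rewrite big1_eq mulr0 !add0r.
have S2 : 0 <= \sum_i Z i w ^+ 2 by apply: sumr_ge0 => i _; exact: sqr_ge0.
have S4 : 0 <= \sum_i Z i w ^+ 4.
  by apply: sumr_ge0 => i _; exact: exprn_even_ge0.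
have := mulr_ge0 (ltW eta0) S2; have := mulr_ge0 C0 S4; lra.
Qed.

(** The eigenvalue equation with [phi = (phi - eps) + eps]; the second summand is the source of the
    error [|lam| * eps]. *)
Let trace_eq w : \sum_i c i i w = - lam * (u w + eps * J w).
Proof.
rewrite /c /u /weighted; have [Sw|nS] := pselect (stay h k w); last first.
  have -> : J w = 0 by rewrite /J indicE memNset.
  by rewrite big1 ?mul0r ?mulr0 ?addr0 ?mulr0// => i _; rewrite mul0r.
have -> : J w = 1 by rewrite /J indicE mem_set.
have Kw : K (grid B h k w) by exact: Sw.
rewrite !patchE mem_set// mul1r mulr1 subrK.
have [_ [_ [_ [_ [hl _]]]]] := eigphi.
rewrite mulNr -(hl _ (KO _ Kw)) opprK /laplacian.
by apply: eq_bigr => i _; rewrite mul1r patchE mem_set.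
Qed.

Let iJ : P.-integrable setT (fun w => (J w)%:E).
Proof.
apply: (bounded_integrable _ _ 1).
  by apply: measurable_indic; exact: measurable_stay_grid.
by move=> w; rewrite /J indicE ger0_norm// lern1 leq_b1.
Qed.

Let iu : P.-integrable setT (fun w => (u w)%:E).
Proof. exact: value_integrable. Qed.

Let uE : \int[P]_w u w = value h k. Proof. by []. Qed.

Let trace_expectation :
  \sum_i \int[P]_w c i i w = - lam * (value h k + eps * fine (P (stay h k))).
Proof.
have [_ <-] := expectation_sum_fin P 'I_n (fun i => c i i) (fun i => ic i i).
have ieJ : P.-integrable setT (fun w => (eps * J w)%:E).
  by under eq_fun do rewrite EFinM; exact: integrableZl.
have iD : P.-integrable setT (fun w => (u w + eps * J w)%:E).
  by under eq_fun do rewrite EFinD; exact: integrableD.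
rewrite (_ : (fun w => \sum_i c i i w) = (fun w => - lam * (u w + eps * J w))); last first.
  by apply/funext => w; exact: trace_eq.
rewrite (RintegralZl _ measurableT iD) (RintegralD measurableT iu ieJ).
rewrite (RintegralZl _ measurableT iJ) expectation_indicator//.
exact: measurable_stay_grid.
Qed.

(** [U] vanishes off [K], so survival at the last step is automatic. Hence the recursion closes with
    a weight that depends on the past alone. *)
Let next_fun : (fun w => \1_(stay h k.+1) w * U (grid B h k.+1 w)) =
  (fun w => J w * U (grid B h k.+1 w)).
Proof.
apply/funext => w; rewrite /J !indicE.
have [Kw|nK] := pselect (K (grid B h k.+1 w)); last first.
  by rewrite U0// !mulr0.
congr (_%:R * _); congr nat_of_bool.
apply/idP/idP => /set_mem Sw; apply/mem_set => j jk.
  by apply: Sw; exact: leqW.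
by move: jk; rewrite leq_eqVlt => /predU1P[->//|jk]; exact: Sw.
Qed.

(** The Hessian term contributes [2^-1 * (2 * h)] times the expected trace, hence [- lam * h]. The
    errors are [eta] times [n] variances [2 * h], and [C] times [n] fourth moments, each at most
    [64 * (2 * h) ^+ 2 = 256 * h ^+ 2]. *)
Lemma value_step :
  (1 - lam * h) * value h k
    - h * (`|lam| * eps + 2 * n%:R * eta + 256 * n%:R * C * h) <= value h k.+1.
Proof.
have [i1 E1] := expectation_sum_fin P 'I_n (fun i w => b i w * Z i w)
  (fun i => (first_order i).1).
have [i2 E2] := expectation_sum_fin P ('I_n * 'I_n)%type
  (fun q w => c q.1 q.2 w * Z q.1 w * Z q.2 w) (fun q => (second_order q.1 q.2).1).
have [i3 E3] := expectation_sum_fin P 'I_n (fun i w => Z i w ^+ 2)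
  (fun i => integrable_normal_sqr P _ _ (mZ i) s0 (lawZ i)).
have [i4 E4] := expectation_sum_fin P 'I_n (fun i w => Z i w ^+ 4)
  (fun i => (normal_exp4 P _ _ (mZ i) s0 (lawZ i)).1).
have [j1 G1] := expectation_add_scale P _ _ 1 iu i1.
have [j2 G2] := expectation_add_scale P _ _ 2^-1 j1 i2.
have [j3 G3] := expectation_add_scale P _ _ (- eta) j2 i3.
have [j4 G4] := expectation_add_scale P _ _ (- C) j3 i4.
have jU : P.-integrable setT (EFin \o (fun w => J w * U (grid B h k.+1 w))).
  by rewrite -next_fun; exact: value_integrable.
have : \int[P]_w (u w + 1 * (\sum_i b i w * Z i w)
    + 2^-1 * (\sum_(q : 'I_n * 'I_n) c q.1 q.2 w * Z q.1 w * Z q.2 w)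
    + - eta * (\sum_i Z i w ^+ 2) + - C * (\sum_i Z i w ^+ 4)) <= value h k.+1.
  rewrite /value next_fun; apply: (le_Rintegral measurableT j4 jU) => w _.
  by have := pointwise w; rewrite mul1r !mulNr.
rewrite G4 G3 G2 G1 uE E1 E2 E3 E4.
have -> : \sum_i \int[P]_w (b i w * Z i w) = 0.
  by apply: big1 => i _; exact: (first_order i).2.
have -> : \sum_(q : 'I_n * 'I_n) \int[P]_w (c q.1 q.2 w * Z q.1 w * Z q.2 w) =
    2 * h * \sum_i \int[P]_w c i i w.
  under eq_bigr => q _ do rewrite (second_order q.1 q.2).2.
  rewrite -(pair_bigA _ (fun i j => if i == j then 2 * h * \int[P]_w c i i w else 0))/=.
  rewrite mulr_sumr; apply: eq_bigr => i _.
  by rewrite -big_mkcond (big_pred1 i)// => j; rewrite eq_sym.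
rewrite trace_expectation.
have -> : \sum_i \int[P]_w (Z i w ^+ 2) = n%:R * (2 * h).
  rewrite (eq_bigr (fun=> 2 * h)) => [|i _].
    by rewrite sumr_const card_ord -[LHS]mulr_natl.
  by rewrite (expectation_normal_sqr P _ _ (mZ i) s0 (lawZ i)).
have S4 : \sum_i \int[P]_w (Z i w ^+ 4) <= n%:R * (256 * h ^+ 2).
  apply: le_trans (_ : \sum_(i < n) 256 * h ^+ 2 <= _).
    apply: ler_sum => i _; have := (normal_exp4 P _ _ (mZ i) s0 (lawZ i)).2.
    by rewrite (_ : 4 = 2 * 2)%N// [_ ^+ (2 * 2)]exprM s2 => /le_trans; apply; nra.
  by rewrite sumr_const card_ord -[leLHS]mulr_natl.
have P0 : 0 <= fine (P (stay h k)) by exact: fine_ge0.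
have P1 : fine (P (stay h k)) <= 1.
  rewrite -lee_fin fineK ?fin_num_measure//; last exact: measurable_stay_grid.
  by apply: probability_le1; exact: measurable_stay_grid.
have le1 : lam * (eps * fine (P (stay h k))) <= `|lam| * eps.
  rewrite (le_trans (ler_norm _))// normrM ler_wpM2l// ger0_norm ?mulr_ge0 ?(ltW e0)//.
  by rewrite ler_piMr// ltW.
have := ler_wpM2l (ltW h0) le1; have := ler_wpM2l C0 S4.
move: (value h k) (value h k.+1) (fine _) => v v' pr; lra.
Qed.

End one_step.

Lemma sup_eigenfunction_ge0 : 0 <= Msup.
Proof.
by apply: le_trans (truncation_le _ _ _ domOm eigphi eps x (ltW e0)); exact: truncation_ge0.
Qed.

Section iteration.
Variables (eta C M1 M2 : R).
Hypotheses (eta0 : 0 < eta) (C0 : 0 <= C).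
Hypothesis HM1 : forall (i : 'I_n) y, K y -> `|'D_(unitv i) phi y| <= M1.
Hypothesis HM2 : forall (i j : 'I_n) y, K y ->
  `|'D_(unitv j) ('D_(unitv i) phi) y| <= M2.
Hypothesis HC : forall y (z : 'rV[R]_n), K y ->
    U y + \sum_i z ord0 i * 'D_(unitv i) phi y
    + 2^-1 * (\sum_i \sum_j z ord0 i * z ord0 j * 'D_(unitv j) ('D_(unitv i) phi) y)
    - eta * \sum_i z ord0 i ^+ 2 - C * \sum_i z ord0 i ^+ 4
    <= U (y + z).
Variables (N : nat) (h : R).
Hypotheses (h0 : 0 < h) (lamh : `|lam| * h <= 1).

Let D := `|lam| * eps + 2 * n%:R * eta + 256 * n%:R * C * h.
Let E := expR (`|lam| * (N%:R * h)).

Let D0 : 0 <= D.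
Proof. by rewrite !addr_ge0 ?mulr_ge0// ltW. Qed.

Let value_le_sup k : 0 <= value h k <= Msup.
Proof.
apply/andP; split.
  by apply: Rintegral_ge0 => w _; rewrite mulr_ge0 ?indicE ?truncation_ge0.
apply: le_trans (value_le h k h0) _; rewrite ler_piMr ?sup_eigenfunction_ge0//.
have mS := measurable_stay_grid h k h0.
by rewrite -lee_fin fineK ?fin_num_measure//; exact: probability_le1.
Qed.

Let exp_le (k : nat) : (k <= N)%N -> expR (lam * (k%:R * h)) <= E.
Proof.
move=> kN; rewrite ler_expR (le_trans (ler_norm _))// normrM.
by rewrite ler_wpM2l// ger0_norm ?mulr_ge0 ?(ltW h0)// ler_pM2r// ler_nat.
Qed.

(** Multiplying by [expR (lam * (k * h))] compensates the decay: [expR (lam * h) * (1 - lam * h) >=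
    1 - lam ^+ 2 * h ^+ 2], so each step loses at most [h * (E * (lam ^+ 2 * h * Msup + D))]. The
    absolute values in [E] and [lamh] allow either sign of [lam]. *)
Lemma value_iter (k : nat) : (k <= N)%N ->
  U x - k%:R * h * (E * (lam ^+ 2 * h * Msup + D)) <=
  expR (lam * (k%:R * h)) * value h k.
Proof.
elim: k => [_|k IH kN]; first by rewrite !mul0r mulr0 expR0 mul1r subr0 value0.
have := IH (ltnW kN); have := exp_le _ (ltnW kN); have := exp_le _ kN.
have -> : lam * (k.+1%:R * h) = lam * (k%:R * h) + lam * h by rewrite -natr1; ring.
rewrite expRD -natr1; set a := expR (lam * (k%:R * h)); set g := expR (lam * h).
have a0 : 0 < a by exact: expR_gt0.
have g0 : 0 < g by exact: expR_gt0.
have step := value_step _ _ _ _ eta0 C0 HM1 HM2 HC N k h h0 kN; rewrite -/D in step.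
have /andP[v0 vM] := value_le_sup k.
have lh : lam * h <= 1 by rewrite (le_trans _ lamh)// ler_wpM2r ?(ltW h0)// ler_norm.
have s2 : 1 - lam ^+ 2 * h ^+ 2 <= g * (1 - lam * h).
  rewrite (_ : _ - _ = (1 + lam * h) * (1 - lam * h)); last by ring.
  by rewrite ler_wpM2r ?subr_ge0// expR_ge1Dx.
move=> agE aE.
have s1 := ler_wpM2l (ltW (mulr_gt0 a0 g0)) step.
have s3 := ler_wpM2l (mulr_ge0 (ltW a0) v0) s2.
have s4 : a * value h k <= E * Msup by rewrite ler_pM// ltW.
have s5 : lam ^+ 2 * h ^+ 2 * (a * value h k) <= lam ^+ 2 * h ^+ 2 * (E * Msup).
  by rewrite ler_wpM2l// mulr_ge0// sqr_ge0.
have s6 := ler_wpM2r (mulr_ge0 (ltW h0) D0) agE.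
move: s1 s3 s5 s6; move: (value h k) (value h k.+1) => v v'.
by move: Msup D E => M0 D1 E1; lra.
Qed.

Lemma eigenfunction_le_stay : Om x -> phi x - eps <=
  expR (lam * (N%:R * h)) * (Msup * fine (P (stay h N)))
  + N%:R * h * (E * (lam ^+ 2 * h * Msup + D)).
Proof.
move=> Ox; rewrite -lerBlDr (le_trans _ (ler_wpM2l (expR_ge0 _) (value_le h N h0)))//.
by apply: le_trans (value_iter N (leqnn N)); rewrite lerD2r; exact: truncation_ge.
Qed.

End iteration.

End discrete_feynman_kac.

(** * Passage to the limit *)

Section dyadic_limit.
Context {R : realType} {n : nat} {d : measure_display} {T : measurableType d}.
Variables (P : probability T R) (x : 'rV[R]_n) (B : R -> T -> 'rV[R]_n).
Hypothesis hB : brownian_motion P x B.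
Variables (Om : set 'rV[R]_n) (t : R).
Hypotheses (oOm : open Om) (t0 : 0 < t).

Definition survival : set T := [set w | forall s, 0 <= s <= t -> Om (B s w)].

Let path_continuous w : {within `[0, +oo[, continuous (fun s => B s w)}.
Proof. by have [_ [h2 _]] := hB; exact: h2. Qed.

Lemma measurable_survival : measurable survival.
Proof.
rewrite (_ : survival = \bigcup_e \bigcap_m \bigcap_(k in [set k | (k <= 2 ^ m)%N])
    (B (k%:R * (t / (2 ^ m)%:R)) @^-1` inner Om e.+1%:R^-1)).
  apply: bigcupT_measurable => e; apply: bigcapT_measurable => m.
  apply: bigcap_measurable; first by exists 0%N.
  move=> k _; apply: measurable_preimage_closed; last exact: inner_closed.
  by have [_ [_ [h3 _]]] := hB; exact: h3.
apply/seteqP; split => w.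
  move=> /(path_in_open_dyadic _ _ t0 (path_continuous w) _ oOm)[e He].
  by exists e => // m _ k km; exact: He.
move=> [e _ He]; apply/(path_in_open_dyadic _ _ t0 (path_continuous w) _ oOm).
by exists e => m k km; exact: He.
Qed.

Lemma hit_prob_survival : 1 - hit_prob P B (~` Om) t = fine (P survival).
Proof.
have mS := measurable_survival.
rewrite /hit_prob (_ : [set w | _] = ~` survival); last first.
  apply/seteqP; split => w /=; first by move=> [s [st nO]] /(_ s st).
  move=> nS; apply: contrapT => h; apply: nS => s st; apply: contrapT => nO.
  by apply: h; exists s.
rewrite probability_setC// fineB ?fin_num_measure// opprB addrCA subrr addr0//.
Qed.

Variables (K : set 'rV[R]_n).
Hypotheses (cK : closed K) (KO : K `<=` Om).

Let h (m : nat) : R := t / (2 ^ m)%:R.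

Let h0 m : 0 < h m. Proof. by rewrite divr_gt0// ltr0n expn_gt0. Qed.

Definition dyadic_stay (m : nat) : set T :=
  [set w | forall j, (j <= 2 ^ m)%N -> K (B (j%:R * (t / (2 ^ m)%:R)) w)].

Let measurable_dyadic_stay m : measurable (dyadic_stay m).
Proof.
apply: (measurable_stay (fun j => B (j%:R * h m))) => // j i _.
by have [_ [_ [h3 _]]] := hB; exact: h3.
Qed.

Lemma dyadic_stay_prob (g : R) : 0 < g ->
  \forall m \near \oo, fine (P (dyadic_stay m)) < fine (P survival) + g.
Proof.
move=> g0; pose I := \bigcap_m dyadic_stay m.
have mI : measurable I by exact: bigcapT_measurable.
have IS : fine (P I) <= fine (P survival).
  have mS := measurable_survival.
  rewrite fine_le ?fin_num_measure//; apply: le_measure; rewrite ?inE//.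
  move=> w Iw s st; apply: KO.
  by apply: (dyadic_closed _ _ t0 (path_continuous w) _ cK _ s st) => m k; exact: Iw.
have cv : (P \o dyadic_stay) m @[m --> \oo] --> P I.
  apply: nonincreasing_cvg_mu => //.
    by rewrite ltey_eq fin_num_measure.
  (* Index [j] at level [m] is index [2 * j] at level [m + 1], so the events decrease. *)
  apply/nonincreasing_seqP => m; apply/subsetPset => w Sw j jm.
  have := Sw (2 * j)%N; rewrite expnS leq_pmul2l// => /(_ jm).
  rewrite !natrM -mulrA; congr (K (B _ _)).
  by field; rewrite pnatr_eq0 -lt0n expn_gt0.
have cvf : fine ((P \o dyadic_stay) m) @[m --> \oo] --> fine (P I).
  by apply: fine_cvg; rewrite fineK ?fin_num_measure.
apply: (cvgr_lt _ cvf).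
by rewrite (le_lt_trans IS)// ltrDl.
Qed.

Lemma mesh_cvg0 (g : R) : 0 < g -> \forall m \near \oo, t / (2 ^ m)%:R < g.
Proof.
move=> g0; have tg : 0 <= t / g by rewrite divr_ge0// ltW.
exists (Num.truncn (t / g)) => // m /= km.
rewrite ltr_pdivrMr ?ltr0n ?expn_gt0// -ltr_pdivrMl// mulrC.
have /andP[_ /lt_le_trans] := truncn_itv tg; apply.
by rewrite ler_nat (leq_ltn_trans km)// ltn_expl.
Qed.

End dyadic_limit.

Theorem theorem1p6 (R : realType) (n : nat) (Om : set 'rV[R]_n)
    (x : 'rV[R]_n) (phi : 'rV[R]_n -> R) (lam : R) :
  bounded_domain Om -> Om x -> dirichlet_eigenfunction Om phi lam ->
  forall lam0 : R, 0 < lam0 ->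
  forall (d : measure_display) (T : measurableType d) (P : probability T R)
         (B : R -> T -> 'rV[R]_n),
  brownian_motion P x B ->
  phi x <= expR (lam / lam0) * (1 - hit_prob P B (~` Om) lam0^-1)
           * sup [set `|phi y| | y in Om].
Proof.
move=> domOm Ox eigphi lam0 l0 d T P B hB.
set t := lam0^-1; have t0 : 0 < t by rewrite invr_gt0.
have oOm : open Om by have [_ []] := domOm.
rewrite (hit_prob_survival _ _ _ hB _ _ oOm t0).
set p := fine _; set M := sup _.
have M0 : 0 <= M by exact: (sup_eigenfunction_ge0 x _ _ _ domOm eigphi 1 ltr01).
set E := expR (`|lam| * t).
have E0 : 0 <= E by exact: expR_ge0.
(* The mesh limit at fixed [eps] and [eta]: [C] has disappeared from the bound, so both can still be
   sent to 0. *)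
have main (eps eta : R) : 0 < eps -> 0 < eta ->
    phi x - eps <= expR (lam * t) * M * p +
      t * E * (`|lam| * eps + 2 * n%:R * eta).
  move=> e0 eta0.
  have [C C0 HC] := truncation_taylor _ _ _ domOm eigphi eps eta e0 eta0.
  have cK := superlevel_compact _ _ _ domOm eigphi eps e0.
  have KO : superlevel Om phi eps `<=` Om by move=> y [].
  have [M1 M10 HM1] := compact_bounded_family 'I_n _ (fun i => 'D_(unitv i) phi) cK
    (fun i y Ky => differentiable_continuous (eigphi.2.1 i y (KO _ Ky))).
  have [M2 M20 HM2] := compact_bounded_family ('I_n * 'I_n)%type _
    (fun q => 'D_(unitv q.2) ('D_(unitv q.1) phi)) cK
    (fun q y Ky => eigphi.2.2.1 q.1 q.2 y (KO _ Ky)).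
  have cK' := superlevel_closed _ _ _ eigphi eps e0.
  (* [G] collects the coefficients of the two vanishing quantities, the excess of the grid survival
     probability over [p] and the mesh; both are made smaller than [g / (G + 1)]. *)
  pose G := expR (lam * t) * M + t * E * (lam ^+ 2 * M + 256 * n%:R * C).
  have A0 : 0 <= expR (lam * t) * M by rewrite mulr_ge0// expR_ge0.
  have B0 : 0 <= t * E * (lam ^+ 2 * M + 256 * n%:R * C).
    apply: mulr_ge0; first by rewrite mulr_ge0// ltW.
    by apply: addr_ge0; apply: mulr_ge0 => //; exact: sqr_ge0.
  have G0 : 0 <= G by exact: addr_ge0.
  apply/ler_addgt0Pr => g g0; pose dlt := g / (G + 1).
  have G1 : 0 < G + 1 by rewrite ltr_wpDl.
  have d0 : 0 < dlt by rewrite divr_gt0.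
  have L1 : 0 < `|lam| + 1 by rewrite ltr_wpDl.
  have F1 := dyadic_stay_prob _ _ _ hB _ _ oOm t0 _ cK' KO dlt d0.
  have F2 := mesh_cvg0 _ t0 dlt d0.
  have F3 := mesh_cvg0 _ t0 ((`|lam| + 1)^-1) (ltac:(by rewrite invr_gt0)).
  have [m [/= pm [hd hl]]] := filter_ex (filterI F1 (filterI F2 F3)).
  have h0 : 0 < t / (2 ^ m)%:R by rewrite divr_gt0// ltr0n expn_gt0.
  have lamh : `|lam| * (t / (2 ^ m)%:R) <= 1.
    apply: le_trans (_ : (`|lam| + 1) * (t / (2 ^ m)%:R) <= _).
      by rewrite ler_wpM2r ?lerDl// ltW.
    by rewrite mulrC -ler_pdivlMr// mul1r ltW.
  have := eigenfunction_le_stay _ _ _ hB _ _ _ domOm eigphi _ e0 eta C M1 M2 eta0 C0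
    HM1 (fun i j => HM2 (i, j)) HC (2 ^ m) _ h0 lamh Ox.
  have -> : (2 ^ m)%:R * (t / (2 ^ m)%:R) = t.
    by rewrite mulrC divfK// pnatr_eq0 -lt0n expn_gt0.
  rewrite -/E -/M -[stay _ _ _ _ _ _]/(dyadic_stay B t (superlevel Om phi eps) m).
  move: pm; rewrite -/p; move: (fine (P (dyadic_stay _ _ _ _))) => pm pmlt.
  move: (t / (2 ^ m)%:R) h0 hd {lamh hl} => h h0 hd.
  have s1 := ler_wpM2l A0 (ltW pmlt); have s2 := ler_wpM2l B0 (ltW hd).
  have s3 : dlt * (G + 1) = g by rewrite /dlt divfK// gt_eqF.
  by move: s3; rewrite /G; move: s1 s2 d0; lra.
(* With [eps = eta = e / c] the total error is exactly [e / c * c = e], the summand 1 of [c]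
   accounting for the [eps] subtracted from [phi x]. *)
apply/ler_addgt0Pr => e e0; pose c := 1 + t * E * (`|lam| + 2 * n%:R).
have c0 : 0 < c by rewrite ltr_pwDl// !mulr_ge0 ?addr_ge0 ?mulr_ge0// ltW.
have ec0 : 0 < e / c by rewrite divr_gt0.
have := main (e / c) (e / c) ec0 ec0.
have : e / c * c = e by rewrite divfK// gt_eqF.
rewrite {2}/c; move: (e / c) => q; rewrite -/t.
by move: (expR (lam * t)) => X; lra.
Qed.
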